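(* Consider the recursion $x_{n+1}=x_n+a(n)[h(x_n,y_n)+M_{n+1}]$ in $\mathbb{R}^d$ under assumptions (A1)–(A3), (S1) and (S2) stated in the context. Then $\sup_{n\ge0}\lVert x_n\rVert<\infty$ almost surely.
   Context: $S$ is a compact metric space and $\{y_n\}_{n\ge0}$ is an $S$-valued process adapted to a filtration $\{\mathcal{F}_n\}$ on a probability space, with $x_0$ $\mathcal{F}_0$-measurable. (A1) $h:\mathbb{R}^d\times S\to\mathbb{R}^d$ is jointly continuous and there is $L>0$ with $\lVert h(x_1,y)-h(x_2,y)\rVert\le L\lVert x_1-x_2\rVert$ for all $x_1,x_2\in\mathbb{R}^d$, $y\in S$. (A2) $\{M_n\}_{n\ge1}$ is a square-integrable martingale difference sequence w.r.t. $\{\mathcal{F}_n\}$ with $E[\lVert M_{n+1}\rVert^2\mid\mathcal{F}_n]\le K(1+\lVert x_n\rVert^2)$, $n\ge0$, for some $K>0$. (A3) $a(n)>0$, $\sum_n a(n)=\infty$, $\sum_n a(n)^2<\infty$ (and $\sup_n a(n)\le1$). Definitions: $h_c(x,y):=h(cx,y)/c$ for $c\ge1$; $h_\infty(x,y)$ is the set of $u$ with $\liminf_{c\to\infty}\lVert h_c(x,y)-u\rVert=0$; $H(x):=\overline{co}\big(\bigcup_{y\in S}h_\infty(x,y)\big)$. (S1) If $c_n\uparrow\infty$, $y_n\to y$ and $\lim_n h_{c_n}(x,y_n)=u\in\mathbb{R}^d$, then $u\in h_\infty(x,y)$. (S2) There is an attracting set $\mathcal{A}$ of the differential inclusion $\dot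 x(t)\in H(x(t))$ with $\sup_{u\in\mathcal{A}}\lVert u\rVert<1$, and the closed unit ball $\overline{B}_1(0)$ is a subset of some fundamental neighborhood of $\mathcal{A}$. Dynamics of a DI: a solution is an absolutely continuous $\mathbf{x}$ with $\dot{\mathbf{x}}(t)\in H(\mathbf{x}(t))$ a.e.; $\Phi_t(x)$ is the set of $\mathbf{x}(t)$ over solutions with $\mathbf{x}(0)=x$, and $\Phi_B(M)=\bigcup_{t\in B,x\in M}\Phi_t(x)$. $N^\epsilon(A)=\{x:d(x,A)<\epsilon\}$. A compact set $A$ is an attracting set if there is a neighborhood $U$ of $A$ (a fundamental neighborhood) such that for every $\epsilon>0$ there is $T(\epsilon)\ge0$ with $\Phi_{[T(\epsilon),\infty)}(U)\subset N^\epsilon(A)$. *)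

(* Defs.v *)
From HB Require Import structures.
From mathcomp Require Import all_boot all_order all_algebra.
From mathcomp Require Import all_classical all_reals all_analysis.
Set Implicit Arguments. Unset Strict Implicit. Unset Printing Implicit Defensive.
Import Order.TTheory GRing.Theory Num.Theory.
Import numFieldNormedType.Exports.
Local Open Scope classical_set_scope.
Local Open Scope ring_scope.

Section defs.
Variable R : realType.

Definition enorm (d : nat) (v : 'rV[R]_d) : R := Num.sqrt (\sum_(i < d) v 0 i ^+ 2).

Definition Neps (d : nat) (A : set 'rV[R]_d) (eps : R) : set 'rV[R]_d :=
  [set z | exists2 a, A a & enorm (z - a) < eps].

Definition cvx (d : nat) (C : set 'rV[R]_d) :=
  forall u v (t : R), C u -> C v -> 0 <= t <= 1 -> C (t *: u + (1 - t) *: v).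
Definition closed_conv_hull (d : nat) (A : set 'rV[R]_d) : set 'rV[R]_d :=
  [set u | forall C, A `<=` C -> closed C -> cvx C -> C u].

Definition abs_cont_on (d : nat) (a b : R) (f : R -> 'rV[R]_d) :=
  forall e : R, 0 < e -> exists2 del : R, 0 < del &
    forall n (u v : 'I_n -> R),
      (forall i, a <= u i /\ u i <= v i /\ v i <= b) ->
      (forall i j : 'I_n, (i < j)%N -> v i <= u j) ->
      \sum_(i < n) (v i - u i) < del ->
      \sum_(i < n) enorm (f (v i) - f (u i)) < e.

Definition DI_solution (d : nat) (H : 'rV[R]_d -> set 'rV[R]_d) (z : R -> 'rV[R]_d) :=
  (forall T : R, 0 <= T -> abs_cont_on 0 T z) /\
  {ae (@lebesgue_measure R), forall t : R, 0 <= t -> derivable z t 1 /\ H (z t) ('D_1 z t)}.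

Definition Phi (d : nat) (H : 'rV[R]_d -> set 'rV[R]_d) (t : R) (x0 : 'rV[R]_d) :=
  [set w | exists z, [/\ DI_solution H z, z 0 = x0 & w = z t]].

Definition attracting_with (d : nat) (H : 'rV[R]_d -> set 'rV[R]_d) (A U : set 'rV[R]_d) :=
  [/\ compact A,
      (exists V, [/\ open V, A `<=` V & V `<=` U]) &
      forall eps : R, 0 < eps -> exists T : R, 0 <= T /\
        forall t x0, T <= t -> U x0 -> Phi H t x0 `<=` Neps A eps].

Variable S : pseudoMetricType R.
Variable d : nat.

Definition hc (h : 'rV[R]_d -> S -> 'rV[R]_d) (c : R) (x : 'rV[R]_d) (y : S) : 'rV[R]_d :=
  c^-1 *: h (c *: x) y.

(* h_inf(x,y) = {u | liminf_{c -> oo} ||h_c(x,y) - u|| = 0} (unfolded; the norm is >= 0) *)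
Definition h_inf (h : 'rV[R]_d -> S -> 'rV[R]_d) (x : 'rV[R]_d) (y : S) : set 'rV[R]_d :=
  [set u | forall e : R, 0 < e -> forall C : R,
     exists c : R, [/\ C <= c, 1 <= c & enorm (hc h c x y - u) < e]].

Definition Hset (h : 'rV[R]_d -> S -> 'rV[R]_d) (x : 'rV[R]_d) : set 'rV[R]_d :=
  closed_conv_hull (\bigcup_(y in [set: S]) h_inf h x y).

Definition S1 (h : 'rV[R]_d -> S -> 'rV[R]_d) :=
  forall (x : 'rV[R]_d) (c : nat -> R) (ys : nat -> S) (y : S) (u : 'rV[R]_d),
    (forall n, 1 <= c n) -> {homo c : m n / (m <= n)%N >-> m <= n} ->
    c n @[n --> \oo] --> +oo ->
    ys n @[n --> \oo] --> y ->
    hc h (c n) x (ys n) @[n --> \oo] --> u ->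
    h_inf h x y u.

Definition S2 (h : 'rV[R]_d -> S -> 'rV[R]_d) :=
  exists (A U : set 'rV[R]_d),
    [/\ attracting_with (Hset h) A U,
        (exists2 r : R, r < 1 & forall u, A u -> enorm u <= r) &
        [set z | enorm z <= 1] `<=` U].
End defs.

Section prob.
Context (R : realType) (dO : measure_display) (Omega : measurableType dO).

(* f is G-measurable (G a sigma-algebra on Omega; Borel sigma-algebra on the target) *)
Definition G_meas (G : set (set Omega)) (T : topologicalType) (f : Omega -> T) :=
  forall U : set T, open U -> G (f @^-1` U).

Definition filtration (F : nat -> set (set Omega)) :=
  forall n, [/\ @sigma_algebra Omega setT (F n), F n `<=` measurable & F n `<=` F n.+1].

Definition cexp_version (P : probability Omega R) (G : set (set Omega)) (X Z : Omega -> R) :=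
  [/\ G_meas G Z, P.-integrable setT (EFin \o Z) &
      forall B, G B -> (\int[P]_(w in B) (Z w)%:E = \int[P]_(w in B) (X w)%:E)%E].
End prob.

(* Main.v *)
Require Import Defs.
From HB Require Import structures.
From mathcomp Require Import all_boot all_order all_algebra.
From mathcomp Require Import all_classical all_reals all_analysis.
From mathcomp Require Import measurable_realfun.
From mathcomp Require Import ring lra.
Set Implicit Arguments. Unset Strict Implicit. Unset Printing Implicit Defensive.
Import Order.TTheory GRing.Theory Num.Theory.
Import numFieldNormedType.Exports.
Local Open Scope classical_set_scope.
Local Open Scope ring_scope.

(**
Cut time into deterministic blocks of length between T and T + 1, rescale each
block by r = max(1, |x_m|), where m is its first index, and subtract from the
rescaled iterates the accumulated noise V. What remains is an Euler scheme for
h_r whose argument is perturbed by V.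

Noise. Switching a noise term off as soon as |x_k| > C r makes its conditional
second moment at most K (1 + C^2) a(k)^2, whatever the integrability of x_k.
Freezing the partial sums once they reach a level e turns Kolmogorov's maximal
inequality into Markov's inequality for the last partial sum, and Borel-Cantelli
shows that almost surely only finitely many blocks reach that level. In the other
blocks a Gronwall estimate gives |x_k| <= C r, so nothing was switched off.

Drift. If |x_m| is large, the steps are small and V is small, the rescaled scheme
leaves a block inside the closed unit ball: otherwise take a sequence of
counterexamples, prolong them to infinite time and pass to a pointwise limit along
an ultrafilter. The limit is locally Lipschitz, hence differentiable almost
everywhere, and its difference quotients are limits of averages of values of h_c
near h_inf, so that it solves the differential inclusion; it starts in the unit
ball and has norm at least 1 at some time >= T, which contradicts (S2).

Hence the norms at the block ends do not increase when they are large.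
*)

(** * Lipschitz functions are differentiable almost everywhere *)

Section lipschitz_derivable.
Context {R : realType}.
Notation mu := (@lebesgue_measure R).

Lemma lebesgue_stieltjes_ocitv (f : cumulative R R) (a b : R) : a <= b ->
  lebesgue_stieltjes_measure f `]a, b]%classic = (f b - f a)%:E.
Proof.
move=> ab; rewrite /lebesgue_stieltjes_measure /measure_extension/=.
rewrite measurable_mu_extE/=; last exact: is_ocitv.
by rewrite wlength_itv_bnd// -EFinB.
Qed.

(* If [f] and [id - f] are both nondecreasing, the Lebesgue measure is the sum
   of their Lebesgue-Stieltjes measures, so the one of [f] has a density. *)
Lemma nondecreasing_nonexpansive_ae_derivable (f : R -> R) :
  {homo f : x y / x <= y} -> {homo (fun x => x - f x) : x y / x <= y} ->
  {ae mu, forall x, derivable f x 1}.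
Proof.
move=> fnd gnd; pose g x := x - f x.
(* The two monotonicities give [0 <= u y - u x <= y - x] for [x <= y], so [u] is nonexpansive. *)
have fg_cont (u : R -> R) : {homo u : x y / x <= y} ->
    {homo (fun x => x - u x) : x y / x <= y} -> continuous u.
  move=> und vnd x; apply/cvgrPdist_lt => e e0; near=> t.
  have xt : `|x - t| < e by near: t; exact: cvgr_dist_lt.
  apply: le_lt_trans xt.
  case: (leP x t) => [xt|/ltW tx].
    have := und _ _ xt; have := vnd _ _ xt => /=.
    by rewrite !ler0_norm ?subr_le0 ?und//; lra.
  have := und _ _ tx; have := vnd _ _ tx => /=.
  by rewrite !ger0_norm ?subr_ge0 ?und//; lra.
have fc : continuous f by exact: fg_cont.
have gc : continuous g.
  apply: fg_cont => //; move=> x y xy; rewrite /g; have := fnd _ _ xy; lra.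
pose fm := isCumulative.Build R _ R f fnd (right_continuousW fc).
pose gm := isCumulative.Build R _ R g gnd (right_continuousW gc).
pose F : cumulative R R := HB.pack f fm.
pose G : cumulative R R := HB.pack g gm.
(* On half-open intervals the increments of [f] and [g] add up to the length; uniqueness of Lebesgue
   measure does the rest. *)
have lebE A : measurable A -> mu A =
    (lebesgue_stieltjes_measure F A + lebesgue_stieltjes_measure G A)%E.
  move=> mA; rewrite -measure_addE.
  apply: (@lebesgue_measure_unique _ (measure_add
    (lebesgue_stieltjes_measure F) (lebesgue_stieltjes_measure G))) mA.
  move=> X [[a b] _ <-]; rewrite [RHS]measure_addE.
  have [ab|ba] := leP a b; last first.
    by rewrite set_itv_ge ?measure0 ?adde0// bnd_simp -leNgt ltW.
  rewrite /lebesgue_measure (lebesgue_stieltjes_ocitv idfun)//.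
  transitivity ((F b - F a)%:E + (G b - G a)%:E)%E; last first.
    by apply/esym; congr (_ + _)%E; exact: lebesgue_stieltjes_ocitv.
  rewrite -EFinD; congr EFin => /=.
  by rewrite /g; ring.
(* Restricting to []-n, n]] makes the Stieltjes measure finite, so that Radon-Nikodym yields an
   integrable density. *)
suff H n : {ae mu, forall x, - n%:R < x -> x < n%:R -> derivable f x 1}.
  have := ae_foralln H; apply: filterS => x Hx.
  have [n xn] : exists n : nat, `|x| < n%:R.
    by exists (Num.bound `|x|); rewrite archi_boundP.
  by apply: (Hx n); move: xn; rewrite ltr_norml => /andP[].
pose D : set R := `](- n%:R), n%:R]%classic.
have mD : measurable (D : set (measurableTypeR R)) by exact: measurable_itv.
have Dfin : (lebesgue_stieltjes_measure F D < +oo)%E.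
  by rewrite lebesgue_stieltjes_ocitv ?ltry//= lerNl (le_trans _ (ler0n _ _))// oppr_le0.
pose nu := mfrestr mD Dfin.
have numu : nu `<< mu.
  apply/null_content_dominatesP => A mA A0.
  have /eqP := etrans (esym (lebE A mA)) A0.
  rewrite padde_eq0 ?measure_ge0// => /andP[/eqP {}A0 _].
  apply/eqP; rewrite eq_le measure_ge0 andbT -A0.
  by apply: le_measure; rewrite ?inE//; exact: measurableI.
have [phi [phi0 phifin phiint phiE]] := radon_nikodym_sigma_finite numu.
pose p x := fine (phi x).
have pE : EFin \o p = phi by apply/funext => x /=; rewrite /p fineK.
have pint : mu.-integrable setT (EFin \o p) by rewrite pE.
have pinti y : mu.-integrable `](- n%:R), y] (EFin \o p).
  by apply: integrableS pint => //; exact: measurable_itv.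
have := @FTC1 R p (BRight (- n%:R)) pinti (open_integrable_locally openT pint).
apply: filterS; first exact: (ae_filter_ringOfSetsType mu).
move=> x Hx nx xn.
have /= [dF _] := Hx nx.
have {}dF : derivable (fun y : R => (\int[mu]_(t in `](- n%:R), y]) p t)%R
    + f (- n%:R)) x 1 by apply: derivableD => //; exact: derivable_cst.
(* For [y] near [x] the interval []-n, y]] lies inside [D], so the integral of the density plus
   [f (-n)] equals [f y]. *)
apply: near_eq_derivable dF; near=> y.
have ny : - n%:R < y by near: y; exact: lt_nbhsr.
have yn : y < n%:R by near: y; exact: lt_nbhsl.
have nuE : nu `](- n%:R), y]%classic = (f y - f (- n%:R))%:E.
  rewrite /nu /mfrestr /mrestr /D setIidl.
    exact: (lebesgue_stieltjes_ocitv F (ltW ny)).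
  by apply: subset_itvl; rewrite bnd_simp ltW.
transitivity (fine (nu `](- n%:R), y]%classic) + f (- n%:R)).
  rewrite -pE in phiE; congr (fine _ + _).
  by apply/esym/phiE; exact: measurable_itv.
by rewrite nuE /= subrK.
Unshelve. all: by end_near. Qed.

(** The affine change [(f x + B x) / (2 B)] has increments between 0 and [y - x], which is the
    monotone case above. *)
Lemma lipschitz_ae_derivable (f : R -> R) (B : R) :
  (forall x y, `|f x - f y| <= B * `|x - y|) ->
  {ae mu, forall x, derivable f x 1}.
Proof.
move=> fL; wlog B0 : B fL / 0 < B.
  move=> /(_ (`|B| + 1)); apply; last by rewrite ltr_wpDl.
  move=> x y; apply: (le_trans (fL x y)); apply: ler_wpM2r => //.
  by rewrite (le_trans (ler_norm _))// lerDl.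
pose g x := (B *+ 2)^-1 * (f x + B * x).
have {}fL x y : x <= y -> - (B * (y - x)) <= f y - f x <= B * (y - x).
  by move=> xy; have := fL y x; rewrite ler_norml (ger0_norm (x := y - x)) ?subr_ge0.
have B2 : 0 < B *+ 2 by rewrite pmulrn_lgt0.
have gd : {ae mu, forall x, derivable g x 1}.
  apply: nondecreasing_nonexpansive_ae_derivable => x y xy; rewrite /g.
    by rewrite ler_pM2l ?invr_gt0//; have := fL _ _ xy; lra.
  rewrite -(ler_pM2l B2) !mulrBr !mulrA mulfV ?gt_eqF// !mul1r.
  by have := fL _ _ xy; lra.
move: gd; apply: filterS; first exact: (ae_filter_ringOfSetsType mu).
move=> x gx.
have -> : f = (fun x => (B *+ 2) * g x - B * x).
  by apply/funext => t; rewrite /g; field; rewrite gt_eqF.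
by apply: derivableB; apply: derivableM => //; exact: derivable_cst.
Qed.

End lipschitz_derivable.

(** * The Euclidean norm and limits along an ultrafilter *)

Section euclidean_norm.
Context {R : realType} {d : nat}.
Implicit Types u v w : 'rV[R]_d.

Lemma enorm_sqr v : enorm v ^+ 2 = \sum_(i < d) v 0 i ^+ 2.
Proof. by rewrite /enorm sqr_sqrtr// sumr_ge0// => i _; rewrite sqr_ge0. Qed.

Lemma enorm_ge0 v : 0 <= enorm v. Proof. exact: sqrtr_ge0. Qed.

Lemma enorm0 : enorm (0 : 'rV[R]_d) = 0.
Proof.
by rewrite /enorm big1 ?sqrtr0// => i _; rewrite mxE expr0n.
Qed.

Lemma enormZ (k : R) v : enorm (k *: v) = `|k| * enorm v.
Proof.
rewrite /enorm -sqrtr_sqr -sqrtrM ?sqr_ge0// mulr_sumr; congr Num.sqrt.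
by apply: eq_bigr => i _; rewrite mxE exprMn.
Qed.

Lemma enormN v : enorm (- v) = enorm v.
Proof. by rewrite -scaleN1r enormZ normrN1 mul1r. Qed.

Lemma enorm_distC u v : enorm (u - v) = enorm (v - u).
Proof. by rewrite -enormN opprB. Qed.

Lemma coord_le_enorm v i : `|v 0 i| <= enorm v.
Proof.
rewrite -(@ler_pXn2r _ 2)// ?nnegrE ?enorm_ge0// enorm_sqr real_normK ?num_real//.
by rewrite (bigD1 i)//= lerDl sumr_ge0// => j _; rewrite sqr_ge0.
Qed.

(** Cauchy-Schwarz: expand the sum of the squares of [enorm v * u 0 i - enorm u * v 0 i] and divide
    by the product of the norms. *)
Lemma enorm_dot_le u v : \sum_(i < d) u 0 i * v 0 i <= enorm u * enorm v.
Proof.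
have [u0|u0] := eqVneq (enorm u) 0.
  rewrite u0 mul0r big1// => i _; have := coord_le_enorm u i.
  by rewrite u0 normr_le0 => /eqP ->; rewrite mul0r.
have [v0|v0] := eqVneq (enorm v) 0.
  rewrite v0 mulr0 big1// => i _; have := coord_le_enorm v i.
  by rewrite v0 normr_le0 => /eqP ->; rewrite mulr0.
have uv0 : 0 < enorm u * enorm v by rewrite mulr_gt0// lt0r enorm_ge0 ?u0 ?v0.
rewrite -subr_ge0 -(pmulr_rge0 _ uv0).
have : 0 <= \sum_(i < d) (enorm v * u 0 i - enorm u * v 0 i) ^+ 2.
  by rewrite sumr_ge0// => i _; rewrite sqr_ge0.
have -> : \sum_(i < d) (enorm v * u 0 i - enorm u * v 0 i) ^+ 2 =
  enorm v ^+ 2 * (\sum_(i < d) u 0 i ^+ 2) +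
  enorm u ^+ 2 * (\sum_(i < d) v 0 i ^+ 2) -
  (enorm u * enorm v *+ 2) * \sum_(i < d) u 0 i * v 0 i.
  rewrite !mulr_sumr -big_split/= -sumrB.
  by apply: eq_bigr => i _; ring.
by rewrite -!enorm_sqr; lra.
Qed.

Lemma enorm_sqrD u v : enorm (u + v) ^+ 2 =
  enorm u ^+ 2 + (\sum_(i < d) u 0 i * v 0 i) *+ 2 + enorm v ^+ 2.
Proof.
rewrite !enorm_sqr -sumrMnl -!big_split/=; apply: eq_bigr => i _.
by rewrite mxE; ring.
Qed.

Lemma enormD u v : enorm (u + v) <= enorm u + enorm v.
Proof.
rewrite -(@ler_pXn2r _ 2)// ?nnegrE ?addr_ge0 ?enorm_ge0// enorm_sqrD.
by have := enorm_dot_le u v; lra.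
Qed.

Lemma enormB u v : enorm (u - v) <= enorm u + enorm v.
Proof. by rewrite (le_trans (enormD _ _))// enormN. Qed.

Lemma enorm_dist_trans v u w : enorm (u - w) <= enorm (u - v) + enorm (v - w).
Proof. by rewrite (le_trans _ (enormD _ _))// addrA subrK. Qed.

Lemma enorm_leD u v : enorm u <= enorm v + enorm (u - v).
Proof. by rewrite (le_trans _ (enormD _ _))// addrC subrK. Qed.

Lemma enorm_sum (I : Type) (s : seq I) (P : pred I) (f : I -> 'rV[R]_d) :
  enorm (\sum_(i <- s | P i) f i) <= \sum_(i <- s | P i) enorm (f i).
Proof.
elim/big_ind2 : _ => //; first by rewrite enorm0.
by move=> u a v b ua vb; rewrite (le_trans (enormD _ _))// lerD.
Qed.

Lemma mx_norm_le_enorm v : `|v| <= enorm v.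
Proof.
rewrite [leLHS]/Num.Def.normr/= mx_normrE bigmax_le ?enorm_ge0// => -[i j] _ /=.
by rewrite (ord1 i) coord_le_enorm.
Qed.

Lemma enorm_le_sum v : enorm v <= \sum_(i < d) `|v 0 i|.
Proof.
rewrite {1}(row_sum_delta v) (le_trans (enorm_sum _ _ _))// ler_sum// => i _.
rewrite enormZ ler_piMr// /enorm (bigD1 i)//= big1 => [|j ji].
  by rewrite !mxE !eqxx expr1n addr0 sqrtr1.
by rewrite !mxE (negbTE ji) andbF expr0n.
Qed.

Lemma enorm_le_mx_norm v : enorm v <= d%:R * `|v|.
Proof.
rewrite (le_trans (enorm_le_sum v))//.
rewrite -[X in X%:R]card_ord mulr_natl -sumr_const ler_sum// => i _.
rewrite [leRHS]/Num.Def.normr/= mx_normrE.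
exact: (le_bigmax _ (fun ij => `|v ij.1 ij.2|) (0, i)).
Qed.

(** The topology on row vectors is that of the max norm; the two norms dominate each other up to the
    factor [d]. The [+ 1] below covers [d = 0]. *)
Lemma cvg_enormP (T : Type) (F : set_system T) {FF : Filter F}
    (f : T -> 'rV[R]_d) (l : 'rV[R]_d) :
  f @ F --> l <-> forall e, 0 < e -> \forall t \near F, enorm (f t - l) < e.
Proof.
split=> [/cvgrPdist_lt fl e e0|fl].
  have e' : 0 < e / (d%:R + 1) by rewrite divr_gt0// ltr_wpDl.
  have := fl _ e'; apply: filterS => t; rewrite ltr_pdivlMr ?ltr_wpDl// => lt_e.
  rewrite enorm_distC (le_lt_trans (enorm_le_mx_norm _))// (le_lt_trans _ lt_e)//.
  by rewrite mulrC ler_wpM2l// lerDl.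
apply/cvgrPdist_lt => e e0; have := fl _ e0; apply: filterS => t.
by rewrite -enormN opprB; apply: le_lt_trans; exact: mx_norm_le_enorm.
Qed.

Lemma enorm_continuous : continuous (@enorm R d).
Proof.
move=> v; have FF : Filter (nbhs v) := nbhs_filter v.
apply/(@cvgrPdist_lt _ _ _ (nbhs v)) => e e0.
have vw := (@cvg_enormP _ (nbhs v) FF id v).1 (@cvg_id _ _) _ e0.
apply: filterS vw => w /=; apply: le_lt_trans.
rewrite ler_norml; have := enorm_leD v w; have := enorm_leD w v.
by rewrite (enorm_distC v w); lra.
Qed.

Lemma closed_enormP (C : set 'rV[R]_d) v : closed C ->
  (forall e, 0 < e -> exists2 c, C c & enorm (v - c) < e) -> C v.
Proof.
move=> cC vC; apply: cC => N /nbhs_ballP[e /= e0 eN].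
have [c Cc vc] := vC _ e0; exists c; split=> //; apply: eN.
rewrite -ball_normE/=; exact: le_lt_trans (mx_norm_le_enorm _) vc.
Qed.

Lemma compact_enorm_ball (B : R) : compact [set v : 'rV[R]_d | enorm v <= B].
Proof.
apply: bounded_closed_compact.
  exists B; split; first exact: num_real.
  by move=> M BM v /= vB; rewrite (le_trans (mx_norm_le_enorm _))// (le_trans vB)// ltW.
rewrite -[X in closed X]/(@enorm R d @^-1` [set x | x <= B]).
by apply: closed_comp; [move=> v _; exact: enorm_continuous|exact: closed_le].
Qed.

End euclidean_norm.

Section ultrafilter_limits.

(** For an ultrafilter a cluster point is a limit: if the preimage of a neighborhood were not in
    [U], its complement would be, against clustering. *)
Lemma ultra_compact_lim (T : Type) (U : set_system T) {UU : UltraFilter U}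
    (X : topologicalType) (K : set X) (f : T -> X) :
  compact K -> U (f @^-1` K) -> exists2 l, K l & f @ U --> l.
Proof.
move=> cK UK; have [l [Kl fl]] := cK (f @ U) _ UK.
exists l => // N lN.
have [//|UN] := in_ultra_setVsetC (f @^-1` N) UU.
by have [x [nNx Nx]] := fl (~` N) N UN lN.
Qed.

Lemma ultra_enorm_lim (R : realType) (d : nat) (T : Type) (U : set_system T)
    {UU : UltraFilter U} (f : T -> 'rV[R]_d) (B : R) :
  U [set t | enorm (f t) <= B] ->
  exists l, forall e, 0 < e -> U [set t | enorm (f t - l) < e].
Proof.
move=> fB; have [l _ fl] := ultra_compact_lim (@compact_enorm_ball R d B) fB.
by exists l; apply/cvg_enormP.
Qed.

(** Any ultrafilter finer than the cofinite filter. It gives limits at uncountably many times at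
    once, with no subsequence to extract. *)
Lemma ultra_nat_exists : exists2 U : set_system nat, UltraFilter U &
  forall n, U [set k | (n <= k)%N].
Proof.
have [U [UU oU]] := ultraFilterLemma (F := \oo) _.
by exists U => // n; apply: oU; exists n.
Qed.

End ultrafilter_limits.

(** * The rescaled vector field *)

(** By induction: adding [f j] turns the old average into a convex combination with weights
    [A / (A + a j)] and [a j / (A + a j)]. *)
Lemma cvx_average (R : realType) (d : nat) (C : set 'rV[R]_d) (a : nat -> R)
    (f : nat -> 'rV[R]_d) (i j : nat) : cvx C -> (i < j)%N ->
  (forall k, (i <= k < j)%N -> 0 < a k) -> (forall k, (i <= k < j)%N -> C (f k)) ->
  C ((\sum_(i <= k < j) a k)^-1 *: \sum_(i <= k < j) a k *: f k).
Proof.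
move=> cC; elim: j => // j IH; rewrite ltnS leq_eqVlt => /predU1P[<-|ij] a0 fC.
  rewrite !big_nat1 scalerA mulVf ?scale1r; first by apply: fC; rewrite leqnn ltnSn.
  by rewrite gt_eqF// a0// leqnn ltnSn.
have ijk k : (i <= k < j)%N -> (i <= k < j.+1)%N.
  by move=> /andP[-> kj]; rewrite ltnS ltnW.
rewrite !(big_nat_recr j) ?(ltnW ij)//=.
set A := \sum_(i <= k < j) a k.
have A0 : 0 < A.
  rewrite /A (big_ltn ij) ltr_wpDr// ?a0 ?leqnn ?ltnS ?(ltnW ij)//.
  by rewrite big_nat_cond sumr_ge0// => k /andP[/andP[ik kj] _]; rewrite ltW// a0// (ltnW ik) ltnS ltnW.
have aj : 0 < a j by rewrite a0// ltnW//= ltnSn.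
have AaN0 : A + a j != 0 by rewrite gt_eqF// addr_gt0.
have := cC (A^-1 *: \sum_(i <= k < j) a k *: f k) (f j) (A / (A + a j)).
rewrite scalerDr !scalerA.
have -> : A / (A + a j) / A = (A + a j)^-1 by field; rewrite ?gt_eqF// addr_gt0.
have -> : 1 - A / (A + a j) = (A + a j)^-1 * a j by field.
apply.
- by apply: IH => // k /ijk; [exact: a0|exact: fC].
- by apply: fC; rewrite ltnW//= ltnSn.
- have Aa : 0 < A + a j by rewrite addr_gt0.
  by rewrite (divr_ge0 (ltW A0) (ltW Aa)) ler_pdivrMr// mul1r lerDl ltW.
Qed.

Section rescaled_field.
Context {R : realType} {d : nat} {S : pseudoMetricType R}.
Variables (h : 'rV[R]_d -> S -> 'rV[R]_d) (L : R).
Hypothesis cS : compact [set: S].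
Hypothesis hcont : continuous (fun p : 'rV[R]_d * S => h p.1 p.2).
Hypothesis L0 : 0 < L.
Hypothesis hL : forall x1 x2 s, enorm (h x1 s - h x2 s) <= L * enorm (x1 - x2).

Lemma h0_bounded : exists2 b : R, 0 <= b & forall y, enorm (h 0 y) <= b.
Proof.
have c0 : continuous (fun y => enorm (h 0 y)).
  move=> y; apply: continuous_comp; last exact: enorm_continuous.
  move=> N /(@hcont (0, y))[[A B] /= [A0 By] AB]; apply: filterS By => t Bt.
  by apply: (AB (0, t)); split => //=; exact: nbhs_singleton.
have /compact_bounded[M [_ HM]] : compact ((fun y => enorm (h 0 y)) @` [set: S]).
  by apply: continuous_compact => //; apply: continuous_subspaceT.
exists (`|M| + 1) => [|y]; first by rewrite addr_ge0.
have : `|enorm (h 0 y)| <= `|M| + 1.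
  by apply: HM; [rewrite (le_lt_trans (ler_norm _))// ltrDl|exists y].
exact/le_trans/ler_norm.
Qed.

Lemma hc_lipschitz c x1 x2 y : 0 < c ->
  enorm (hc h c x1 y - hc h c x2 y) <= L * enorm (x1 - x2).
Proof.
move=> c0; rewrite /hc -scalerBr enormZ gtr0_norm ?invr_gt0//.
rewrite ler_pdivrMl// (le_trans (hL _ _ _))// -scalerBr enormZ gtr0_norm//.
by rewrite mulrCA.
Qed.

(** Rescaling preserves the Lipschitz constant and shrinks the value at 0, so the linear growth
    bound is uniform in [c >= 1]. *)
Lemma hc_growth b c x y : (forall y, enorm (h 0 y) <= b) -> 1 <= c ->
  enorm (hc h c x y) <= b + L * enorm x.
Proof.
move=> hb c1; have c0 : 0 < c by exact: lt_le_trans c1.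
rewrite (le_trans (enorm_leD _ (hc h c 0 y)))//; apply: lerD; last first.
  by rewrite (le_trans (hc_lipschitz _ _ _ c0))// subr0.
rewrite /hc scaler0 enormZ gtr0_norm ?invr_gt0// ler_pdivrMl//.
by rewrite (le_trans (hb y))// ler_peMl// (le_trans (enorm_ge0 _) (hb y)).
Qed.

(* (S1) and the compactness of S make the convergence to h_inf uniform in y. *)
Lemma hc_near_h_inf x e : S1 h -> 0 < e ->
  exists C, forall c, C <= c -> 1 <= c -> forall y,
    exists2 u, (\bigcup_(y' in [set: S]) h_inf h x y') u & enorm (hc h c x y - u) < e.
Proof.
move=> hS1 e0; apply: contrapT => abs.
have {}abs (n : nat) : exists q : R * S, [/\ n%:R <= q.1, 1 <= q.1 &
    forall u, (\bigcup_(y' in [set: S]) h_inf h x y') u ->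
      e <= enorm (hc h q.1 x q.2 - u)].
  apply: contrapT => nex; apply: abs; exists n%:R => c nc c1 y.
  apply: contrapT => nu; apply: nex; exists (c, y); split => // u hu /=.
  by rewrite leNgt; apply/negP => lt_e; apply: nu; exists u.
have {abs} [f fP] := choice abs.
have [b b0 hb] := h0_bounded.
have [U UU Ucof] := ultra_nat_exists.
have [y _ Uy] := @ultra_compact_lim _ U _ S _ (fun n => (f n).2) cS (filterE _ (fun=> I)).
have [u Uu] : exists u, forall e, 0 < e ->
    U [set n | enorm (hc h (f n).1 x (f n).2 - u) < e].
  apply: (@ultra_enorm_lim _ _ _ _ _ _ (b + L * enorm x)); apply: filterE => n /=.
  by apply: hc_growth => //; have [] := fP n.
(* (S1) asks for nondecreasing scales, so [g] finds a sample whose scale exceeds a given number,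
   within a given tolerance of the limits; [m] iterates it from the previous scale. *)
have /choice[g gP] (q : R * nat) : exists n, [/\ q.1 <= (f n).1,
    ball y q.2.+1%:R^-1 (f n).2 & enorm (hc h (f n).1 x (f n).2 - u) < q.2.+1%:R^-1].
  have i0 : 0 < q.2.+1%:R^-1 :> R by rewrite invr_gt0.
  have Uyq : U [set n | ball y q.2.+1%:R^-1 (f n).2] by apply: Uy; exact: nbhsx_ballx.
  have [n [/= un [yn qn]]] :=
    filter_ex (filterI (Uu _ i0) (filterI Uyq (Ucof (Num.bound `|q.1|)))).
  exists n; split => //; have [nf _ _] := fP n.
  rewrite (le_trans _ nf)// (le_trans (ler_norm _))// (le_trans (ltW (archi_boundP _)))//.
  by rewrite ler_nat.
pose fix m k := if k is k'.+1 then g (Num.max (f (m k')).1 k%:R, k) else g (1, 0%N).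
have mP k : ball y k.+1%:R^-1 (f (m k)).2 /\
    enorm (hc h (f (m k)).1 x (f (m k)).2 - u) < k.+1%:R^-1.
  by case: k => [|k] /=; [have [] := gP (1, 0%N)|
    have [] := gP (Num.max (f (m k)).1 k.+1%:R, k.+1)].
have mS k : (f (m k)).1 <= (f (m k.+1)).1 /\ k.+1%:R <= (f (m k.+1)).1.
  have [+ _ _] := gP (Num.max (f (m k)).1 k.+1%:R, k.+1).
  by rewrite /= ge_max => /andP[].
have mk k : k%:R <= (f (m k)).1.
  case: k => [|k]; last by have [] := mS k.
  by have [_ c1 _] := fP (m 0%N); rewrite (le_trans ler01).
have smallN e' : 0 < e' -> \forall k \near \oo, (k.+1%:R^-1 : R) < e'.
  by move=> e'0; exact: near_infty_natSinv_lt (PosNum e'0).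
have hu : h_inf h x y u.
  apply: (hS1 x (fun k => (f (m k)).1) (fun k => (f (m k)).2) y u).
  - by move=> k; have [] := fP (m k).
  - by apply: homo_leq => [//|? ? ?|k]; [exact: le_trans|have [] := mS k].
  - apply/cvgryPge => A; near=> k.
    have kA : A <= k%:R by near: k; exact: nbhs_infty_ger.
    exact: le_trans kA (mk k).
  - apply/cvg_ballP => e' e'0; near=> k.
    have ke' : k.+1%:R^-1 < e' by near: k; exact: smallN.
    by apply: le_ball (ltW ke') _ _; have [] := mP k.
  - apply/cvg_enormP => e' e'0; near=> k.
    have ke' : k.+1%:R^-1 < e' by near: k; exact: smallN.
    by apply: lt_trans ke'; have [] := mP k.
(* By (S1) the limit [u] belongs to [h_inf], yet the samples come closer to it than [e]. *)
have [k _ /(_ k (leqnn _)) /= ke] := smallN e e0.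
have [_ _ /(_ u)] := fP (m k).
rewrite leNgt (lt_trans _ ke); last by have [] := mP k.
by move=> /(_ (ex_intro2 _ _ y I hu)).
Unshelve. all: by end_near. Qed.

End rescaled_field.

(** * Limits of Euler schemes *)

(** Clamping time to [[0, n]] makes each coordinate globally Lipschitz, and the clamp is the
    identity near any [t] in []0, n[]. *)
Lemma locally_lipschitz_ae_derivable (R : realType) (d : nat) (z : R -> 'rV[R]_d) :
  (forall T, exists B, forall t u, 0 <= t -> t <= u -> u <= T ->
     enorm (z u - z t) <= B * (u - t)) ->
  {ae (@lebesgue_measure R), forall t, 0 < t -> derivable z t 1}.
Proof.
move=> zL; pose clamp (n : nat) (x : R) := Num.min (Num.max x 0) n%:R.
have clamp0 n x : 0 <= clamp n x by rewrite le_min le_max lexx orbT/=.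
have clampn n x : clamp n x <= n%:R by rewrite ge_min lexx orbT.
have clampL n x y : x <= y -> clamp n x <= clamp n y <= clamp n x + (y - x).
  rewrite /clamp; case: (leP x 0) => x0; case: (leP y 0) => y0;
    case: (leP x n%:R) => xn; case: (leP y n%:R) => yn; case: (leP (0 : R) n%:R) => n0 xy;
    have := ler0n R n; lra.
have H (j : 'I_d) n : {ae (@lebesgue_measure R), forall t,
    derivable (fun x => z (clamp n x) 0 j) t 1}.
  have [B BP] := zL n%:R.
  have BP' x y : x <= y -> `|z (clamp n y) 0 j - z (clamp n x) 0 j| <= `|B| * (y - x).
    move=> xy; have /andP[cxy cyx] := clampL n _ _ xy.
    have := coord_le_enorm (z (clamp n y) - z (clamp n x)) j; rewrite !mxE => /le_trans; apply.
    rewrite (le_trans (BP _ _ _ _ _))// (le_trans (ler_wpM2r _ (ler_norm B)))// ?subr_ge0//.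
    by rewrite ler_wpM2l//; lra.
  apply: (@lipschitz_ae_derivable R _ `|B|) => x y.
  case: (leP x y) => [xy|/ltW yx].
    by rewrite distrC (distrC x) (ger0_norm (x := y - x)) ?subr_ge0 ?BP'.
  by rewrite (ger0_norm (x := x - y)) ?subr_ge0 ?BP'.
have {}H n : {ae (@lebesgue_measure R), forall t, forall j : 'I_d,
    derivable (fun x => z (clamp n x) 0 j) t 1}.
  have FF := ae_filter_ringOfSetsType (@lebesgue_measure R).
  exact: (@filter_forall _ _ (fun (j : 'I_d) (t : R) =>
    derivable (fun x => z (clamp n x) 0 j) t 1) _ FF (fun j => H j n)).
have := ae_foralln H; apply: filterS.
move=> t Ht t0; apply/derivable_mxP => i j; rewrite (ord1 i).
have [n tn] : exists n : nat, t < n%:R by exists (Num.bound t); rewrite archi_boundP// ltW.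
apply: near_eq_derivable (Ht n j); near=> x.
have x0 : 0 < x by near: x; exact: lt_nbhsr.
have xn : x < n%:R by near: x; exact: lt_nbhsl.
by rewrite /clamp (max_l (ltW x0)) (min_l (ltW xn)).
Unshelve. all: by end_near. Qed.

Section euler_scheme.
Context {R : realType} {d : nat} {S : pseudoMetricType R}.
Variables (h : 'rV[R]_d -> S -> 'rV[R]_d) (L b : R).
Hypothesis L0 : 0 < L.
Hypothesis hL : forall x1 x2 s, enorm (h x1 s - h x2 s) <= L * enorm (x1 - x2).
Hypothesis b0 : 0 <= b.
Hypothesis hb : forall y, enorm (h 0 y) <= b.

(** Gronwall bound for growth at rate [b + L (|v| + 1)] from [|v| <= 1]; the shift [(b + L) / L]
    makes this rate linear. *)
Definition euler_bound (t : R) := (1 + (b + L) / L) * expR (L * t).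

(** Bounds the field along a scheme up to time [t]; the inner [+ 1] is for the perturbation of the
    argument. *)
Definition euler_speed (t : R) := b + L * (euler_bound t + 1).

Lemma euler_bound_ge0 t : 0 <= euler_bound t.
Proof. by rewrite mulr_ge0 ?expR_ge0// addr_ge0// divr_ge0 ?addr_ge0 ?(ltW L0). Qed.

Lemma euler_bound_le t u : t <= u -> euler_bound t <= euler_bound u.
Proof.
move=> tu; rewrite ler_wpM2l ?addr_ge0 ?divr_ge0 ?addr_ge0 ?(ltW L0)//.
by rewrite ler_expR ler_pM2l.
Qed.

Lemma euler_speed_ge0 t : 0 <= euler_speed t.
Proof. by rewrite addr_ge0// mulr_ge0 ?(ltW L0)// addr_ge0// euler_bound_ge0. Qed.

(** Discrete Gronwall: each step multiplies the shifted norm by at most [1 + L * a n], hence by at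
    most [expR (L * a n)]. *)
Lemma euler_growth c n (a : nat -> R) (v E : nat -> 'rV[R]_d) (s : nat -> S) :
  1 <= c -> (forall k, (k < n)%N -> 0 <= a k) ->
  (forall k, (k < n)%N -> enorm (E k) <= 1) -> enorm (v 0%N) <= 1 ->
  (forall k, (k < n)%N -> v k.+1 = v k + a k *: hc h c (v k + E k) (s k)) ->
  enorm (v n) <= euler_bound (series a n).
Proof.
move=> c1 a0 E1 v0 vS; pose q := (b + L) / L.
have q0 : 0 <= q by rewrite divr_ge0 ?addr_ge0 ?(ltW L0).
suff : enorm (v n) + q <= euler_bound (series a n).
  by apply: le_trans; rewrite lerDl.
elim: n a0 E1 vS => [|n IH] a0 E1 vS.
  by rewrite /euler_bound /series/= big_geq// mulr0 expR0 mulr1 -/q lerD2r.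
have {}IH : enorm (v n) + q <= euler_bound (series a n).
  by apply: IH => k kn; [apply: a0|apply: E1|apply: vS]; rewrite ltnW.
have an : 0 <= a n by exact: a0.
have vE : enorm (v n.+1) + q <= (1 + L * a n) * (enorm (v n) + q).
  have -> : (1 + L * a n) * (enorm (v n) + q) =
      enorm (v n) + a n * (b + L * (enorm (v n) + 1)) + q.
    by rewrite /q; field; rewrite gt_eqF.
  rewrite lerD2r vS// (le_trans (enormD _ _))// lerD2l enormZ ger0_norm//.
  rewrite ler_wpM2l// (le_trans (hc_growth hL _ _ hb c1))// lerD2l ler_pM2l//.
  by rewrite (le_trans (enormD _ _))// lerD2l E1.
have -> : euler_bound (series a n.+1) = expR (L * a n) * euler_bound (series a n).
  by rewrite /euler_bound seriesSr (mulrDr L) expRD mulrA mulrC.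
rewrite (le_trans vE)// ler_pM ?expR_ge1Dx ?addr_ge0 ?enorm_ge0//.
by rewrite mulr_ge0// ltW.
Qed.

(** Here [v + E] stands for the rescaled iterate and [E] for the accumulated noise, which enters
    only through the argument of the field. The scheme runs forever. *)
Definition euler_scheme (c e : R) (a : nat -> R) (v E : nat -> 'rV[R]_d) (s : nat -> S) :=
  [/\ 1 <= c, forall k, 0 < a k <= e, forall k, enorm (E k) <= e,
      enorm (v 0%N) <= 1 &
      forall k, v k.+1 = v k + a k *: hc h c (v k + E k) (s k)].

Section one_scheme.
Variables (c e : R) (a : nat -> R) (v E : nat -> 'rV[R]_d) (s : nat -> S).
Hypothesis sch : euler_scheme c e a v E s.
Hypothesis e1 : e <= 1.

Lemma euler_step_gt0 k : 0 < a k.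
Proof. by have [_ /(_ k)/andP[]] := sch. Qed.

Lemma euler_step_le k : a k <= e.
Proof. by have [_ /(_ k)/andP[]] := sch. Qed.

Lemma euler_time_le i j : (i <= j)%N -> series a i <= series a j.
Proof.
move=> ij; rewrite -subr_ge0 sub_series_geq// sumr_ge0// => k _.
exact/ltW/euler_step_gt0.
Qed.

Lemma euler_time_lt_inv i j : series a i < series a j -> (i < j)%N.
Proof. by move=> ij; rewrite ltnNge; apply/negP => /euler_time_le; rewrite leNgt ij. Qed.

Lemma euler_scheme_bound k : enorm (v k) <= euler_bound (series a k).
Proof.
have [c1 _ Ee v0 vS] := sch; apply: (@euler_growth c _ _ _ E s) => // i _.
  exact/ltW/euler_step_gt0.
exact: le_trans (Ee i) e1.
Qed.

Lemma euler_field_bound k t : series a k <= t ->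
  enorm (hc h c (v k + E k) (s k)) <= euler_speed t.
Proof.
have [c1 _ Ee v0 vS] := sch => kt.
rewrite (le_trans (hc_growth hL _ _ hb c1))// lerD2l ler_pM2l//.
rewrite (le_trans (enormD _ _))// lerD//; last exact: le_trans (Ee k) e1.
by rewrite (le_trans (euler_scheme_bound k))// euler_bound_le.
Qed.

Lemma euler_incrE i j : (i <= j)%N ->
  v j - v i = \sum_(i <= k < j) a k *: hc h c (v k + E k) (s k).
Proof.
have [c1 _ Ee v0 vS] := sch; elim: j => [|j IH].
  by rewrite leqn0 => /eqP ->; rewrite subrr big_geq.
rewrite leq_eqVlt => /predU1P[<-|]; first by rewrite subrr big_geq.
by rewrite ltnS => ij; rewrite big_nat_recr//= -IH// vS addrAC.
Qed.

Lemma euler_incr_le i j t : (i <= j)%N -> series a j <= t ->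
  enorm (v j - v i) <= euler_speed t * (series a j - series a i).
Proof.
move=> ij jt; rewrite euler_incrE// (le_trans (enorm_sum _ _ _))//.
rewrite sub_series_geq// mulr_sumr !big_nat; apply: ler_sum => k /andP[ik kj].
rewrite enormZ gtr0_norm ?euler_step_gt0// mulrC ler_pM2r ?euler_step_gt0//.
by apply: euler_field_bound; rewrite (le_trans _ jt)// euler_time_le// ltnW.
Qed.

End one_scheme.

Lemma euler_index (a : nat -> R) (t : R) : (exists k, t < series a k) -> 0 <= t ->
  exists k, series a k <= t < series a k.+1.
Proof.
move=> [m tm] t0.
have ex : exists k, t < series a k by exists m.
case: (ex_minnP ex) => -[|k] tk mink; first by move: tk; rewrite /series/= big_geq// ltNge t0.
exists k; rewrite tk andbT leNgt; apply/negP => /mink; by rewrite ltnn.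
Qed.

(** * Passage to the limit along an ultrafilter *)

Section limit.
Hypothesis hS1 : S1 h.
Hypothesis cS : compact [set: S].
Hypothesis hcont : continuous (fun p : 'rV[R]_d * S => h p.1 p.2).
Variables (U : set_system nat) (UU : UltraFilter U).
Variables (c e : nat -> R) (a : nat -> nat -> R) (v E : nat -> nat -> 'rV[R]_d).
Variables (s : nat -> nat -> S).
Hypothesis sch : forall p, euler_scheme (c p) (e p) (a p) (v p) (E p) (s p).
Hypothesis e1 : forall p, e p <= 1.
Hypothesis c_large : forall C, U [set p | C <= c p].
Hypothesis e_small : forall r, 0 < r -> U [set p | e p < r].
(** The last index whose time is at most [t]: [v p (kap p t)] is the piecewise constant
    interpolation, and [z] is its pointwise limit. *)
Variable kap : nat -> R -> nat.
Hypothesis kapP : forall p t, 0 <= t ->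
  series (a p) (kap p t) <= t < series (a p) (kap p t).+1.
Variable z : R -> 'rV[R]_d.
Hypothesis zlim : forall t, 0 <= t -> forall r, 0 < r ->
  U [set p | enorm (v p (kap p t) - z t) < r].

Lemma kap_mono p t u : 0 <= t -> t <= u -> (kap p t <= kap p u)%N.
Proof.
move=> t0 tu; rewrite -ltnS; apply: (euler_time_lt_inv (sch p)).
have /andP[kt _] := kapP p t0; have /andP[_ ku] := kapP p (le_trans t0 tu).
exact: le_lt_trans kt (le_lt_trans tu ku).
Qed.

Lemma kap_time p t : 0 <= t ->
  series (a p) (kap p t) <= t < series (a p) (kap p t) + e p.
Proof.
move=> t0; have /andP[-> /lt_le_trans] := kapP p t0; apply.
by rewrite seriesSr lerD2l (euler_step_le (sch p)).
Qed.

(** The index [kap p t] lags behind [t] by less than [e p], so the increment bound of the schemes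
    holds up to an error vanishing in the limit. *)
Lemma euler_limit_lipschitz t u : 0 <= t -> t <= u ->
  enorm (z u - z t) <= euler_speed u * (u - t).
Proof.
move=> t0 tu; have u0 := le_trans t0 tu.
apply/ler_addgt0Pr => r r0.
have B0 := euler_speed_ge0 u; set B := euler_speed u in B0 *.
have r3 : 0 < r / 3 by rewrite divr_gt0.
have rB : 0 < r / 3 / (B + 1) by rewrite divr_gt0// ltr_wpDl.
have [p [/= pu [pt pe]]] :=
  filter_ex (filterI (zlim u0 r3) (filterI (zlim t0 r3) (e_small rB))).
have inc : enorm (v p (kap p u) - v p (kap p t)) <= B * (u - t) + r / 3.
  have /andP[ku _] := kap_time p u0; have /andP[_ kt] := kap_time p t0.
  rewrite (le_trans (euler_incr_le (sch p) (e1 p) (kap_mono p t0 tu) ku))//.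
  have Be : B * e p <= r / 3.
    have : (B + 1) * e p <= r / 3.
      by rewrite mulrC -ler_pdivlMr ?ltr_wpDl// ltW.
    apply: le_trans; rewrite ler_wpM2r// ?lerDl//.
    by rewrite (le_trans (enorm_ge0 (E p 0%N)))//; have [] := sch p.
  rewrite (le_trans (y := B * (u - t + e p)))//; last by rewrite mulrDr lerD2l.
  by rewrite ler_wpM2l//; lra.
have := enorm_dist_trans (v p (kap p u)) (z u) (z t).
have := enorm_dist_trans (v p (kap p t)) (v p (kap p u)) (z t).
rewrite (enorm_distC (z u) (v _ _)); lra.
Qed.

(* The difference quotients of the limit are close to averages of values of the
   rescaled field near [z t], hence to any convex set containing h_inf. *)
Lemma euler_limit_quotient t (C : set 'rV[R]_d) r : 0 <= t -> cvx C ->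
  \bigcup_(y in [set: S]) h_inf h (z t) y `<=` C -> 0 < r ->
  exists2 t1, 0 < t1 & forall u, 0 < u < t1 ->
    exists2 w, C w & enorm (u^-1 *: (z (t + u) - z t) - w) < r.
Proof.
move=> t0 cC hC r0.
have r4 : 0 < r / 4 by rewrite divr_gt0.
have [c0 hc0] := hc_near_h_inf cS hcont hL (z t) hS1 r4.
have B0 := euler_speed_ge0 (t + 1); set B := euler_speed (t + 1) in B0 *.
(* Moving the argument by at most [g] changes the rescaled field by at most [r / 4]; [t1] keeps the
   drift over time [u] below [g / 4]. *)
pose g := r / 4 / L; have g0 : 0 < g by rewrite !divr_gt0.
pose t1 := Num.min 1 (g / 4 / (B + 1)).
have B1 : 0 < B + 1 by rewrite ltr_wpDl.
exists t1 => [|u /andP[u0]]; first by rewrite lt_min ltr01 !divr_gt0.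
rewrite lt_min => /andP[u1]; rewrite ltr_pdivlMr// => uB.
have tu0 : 0 <= t + u by rewrite addr_ge0// ltW.
(* The bound [g / 4] keeps the arguments near [z t]; [u * r / 16] at both ends costs [r / 8] after
   division by [u]. *)
pose r' := Num.min (g / 4) (u * r / 16).
have r'0 : 0 < r' by rewrite lt_min !divr_gt0// mulr_gt0.
(* In order: the two indices differ; the perturbation is at most [g / 4]; so is the drift due to the
   time lag; replacing [D] by [u] costs at most [r / 16]. *)
pose e' := Num.min (u / 2) (Num.min (g / 4) (Num.min (g / 4 / (B + 1)) (u * r / 16 / (B + 1)))).
have e'0 : 0 < e' by rewrite !lt_min !divr_gt0// mulr_gt0.
have [p [/= pu [pt [pe pc]]]] := filter_ex (filterI (zlim tu0 r'0)
  (filterI (zlim t0 r'0) (filterI (e_small e'0) (c_large c0)))).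
have [c1 _ Ee _ _] := sch p.
have ep0 : 0 <= e p by exact: le_trans (enorm_ge0 _) (Ee 0%N).
move: pe; rewrite !lt_min !(ltr_pdivlMr _ _ B1) => /and4P[pe1 pe2 pe3 pe4].
move: pu pt; rewrite !lt_min => /andP[pu1 pu2] /andP[pt1 pt2].
have tu : t <= t + u by rewrite lerDl ltW.
have /andP[ku1 ku2] := kap_time p tu0; have /andP[kt1 kt2] := kap_time p t0.
set i := kap p t in kt1 kt2 pt1 pt2 *; set j := kap p (t + u) in ku1 ku2 pu1 pu2 *.
have ij : (i <= j)%N by exact: kap_mono.
have ijlt : (i < j)%N.
  by apply: (euler_time_lt_inv (sch p)); lra.
pose D := series (a p) j - series (a p) i.
have D0 : 0 < D by rewrite /D; lra.
pose f k := hc h (c p) (v p k + E p k) (s p k).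
have jt1 : series (a p) j <= t + 1 by rewrite (le_trans ku1)// lerD2l ltW.
(* The enlargement of [C] by [r / 2] is still convex; it absorbs [r / 4] for moving the argument to
   [z t] and [r / 4] for the distance to [h_inf]. *)
pose C' := [set w | exists2 w', C w' & enorm (w - w') <= r / 2].
have cC' : cvx C'.
  move=> w1 w2 q [w1' Cw1 w1w] [w2' Cw2 w2w] q01.
  exists (q *: w1' + (1 - q) *: w2'); first exact: cC.
  have /andP[q0 q1] := q01.
  rewrite opprD addrACA -!scalerBr (le_trans (enormD _ _))// !enormZ.
  rewrite !ger0_norm ?subr_ge0//.
  have -> : r / 2 = q * (r / 2) + (1 - q) * (r / 2) by ring.
  by rewrite lerD// ler_wpM2l ?subr_ge0.
have fC' k : (i <= k < j)%N -> C' (f k).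
  move=> /andP[ik kj].
  have kt : series (a p) k <= t + 1.
    by rewrite (le_trans _ jt1)// (euler_time_le (sch p))// ltnW.
  have [w hw wr] := hc0 _ pc c1 (s p k).
  exists w; first exact: hC.
  have zk : enorm (v p k + E p k - z t) <= g.
    have -> : v p k + E p k - z t = (v p k - v p i) + (v p i - z t) + E p k.
      by rewrite addrA subrK addrAC.
    have := enormD (v p k - v p i + (v p i - z t)) (E p k).
    have := enormD (v p k - v p i) (v p i - z t).
    have := Ee k.
    have := euler_incr_le (sch p) (e1 p) ik kt; rewrite -/B.
    have : B * (series (a p) k - series (a p) i) <= B * u + B * e p.
      rewrite -mulrDr ler_wpM2l//.
      have := euler_time_le (sch p) (ltnW kj); lra.
    have : B * u <= g / 4 by rewrite (le_trans _ (ltW uB))// mulrC ler_pM2l// lerDl.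
    have : B * e p <= g / 4 by rewrite (le_trans _ (ltW pe3))// mulrC ler_wpM2l// lerDl.
    lra.
  have := enorm_dist_trans (hc h (c p) (z t) (s p k)) (f k) w.
  have : enorm (f k - hc h (c p) (z t) (s p k)) <= r / 4.
    rewrite (le_trans (hc_lipschitz hL _ _ _ (lt_le_trans ltr01 c1)))//.
    by rewrite mulrC -ler_pdivlMr.
  lra.
have := cvx_average cC' ijlt (fun k _ => euler_step_gt0 (sch p) k) fC'.
rewrite -(euler_incrE (sch p) ij) -sub_series_geq// -/D.
move=> [w Cw Dw]; exists w => //.
have inc := euler_incr_le (sch p) (e1 p) ij jt1; rewrite -/B -/D in inc.
set A := v p j - v p i in Dw inc.
(* The total error is at most [r / 8 + r / 16 + r / 2], which is less than [r]. *)
have q1 : enorm (u^-1 *: (z (t + u) - z t) - u^-1 *: A) <= r / 8.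
  rewrite -scalerBr enormZ gtr0_norm ?invr_gt0// ler_pdivrMl//.
  have -> : z (t + u) - z t - A = (z (t + u) - v p j) - (z t - v p i).
    by rewrite /A !opprB addrACA [RHS]addrACA (addrC (- z t)).
  rewrite (le_trans (enormB _ _))// (enorm_distC (z (t + u))) (enorm_distC (z t)).
  lra.
have q2 : enorm (u^-1 *: A - D^-1 *: A) <= r / 16.
  rewrite -scalerBl enormZ.
  have -> : u^-1 - D^-1 = (D - u) / (u * D).
    by field; rewrite (gt_eqF u0) (gt_eqF D0).
  rewrite normrM (gtr0_norm (x := (u * D)^-1)) ?invr_gt0 ?mulr_gt0//.
  rewrite mulrAC ler_pdivrMr ?mulr_gt0//.
  have Du : `|D - u| <= e p by rewrite ler_norml /D; lra.
  rewrite (le_trans (ler_pM _ _ Du inc))// ?enorm_ge0//.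
  by rewrite mulrA (mulrA (r / 16)) ler_pM2r//; lra.
have := enorm_dist_trans (u^-1 *: A) (u^-1 *: (z (t + u) - z t)) w.
have := enorm_dist_trans (D^-1 *: A) (u^-1 *: A) w.
lra.
Qed.

(** The closed convex hull is an intersection of closed convex sets, and the derivative, as a limit
    of quotients ever closer to each of them, lies in all. *)
Lemma euler_limit_solution : DI_solution (Hset h) z.
Proof.
have speed_le t u : t <= u -> euler_speed t <= euler_speed u.
  by move=> tu; rewrite lerD2l ler_pM2l// lerD2r euler_bound_le.
have zL T t u : 0 <= t -> t <= u -> u <= T ->
    enorm (z u - z t) <= euler_speed T * (u - t).
  move=> t0 tu uT; rewrite (le_trans (euler_limit_lipschitz t0 tu))//.
  by rewrite ler_wpM2r ?subr_ge0 ?speed_le.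
split=> [T T0 r r0|].
  have B0 := euler_speed_ge0 T; have B1 : 0 < euler_speed T + 1 by rewrite ltr_wpDl.
  exists (r / (euler_speed T + 1)) => [|n x y xy _ xyr]; first by rewrite divr_gt0.
  move: xyr; rewrite ltr_pdivlMr// => xyr.
  apply: le_lt_trans xyr; rewrite mulr_suml; apply: ler_sum => i _.
  have [x0 [xyi yT]] := xy i; rewrite (le_trans (zL T _ _ _ _ _))// mulrC.
  by rewrite ler_wpM2l ?subr_ge0// lerDl.
have zd : {ae (@lebesgue_measure R), forall t, 0 < t -> derivable z t 1}.
  by apply: locally_lipschitz_ae_derivable => T; exists (euler_speed T); exact: zL.
have z0 : {ae (@lebesgue_measure R), forall t, t != 0}.
  exists [set 0]; split; [exact: measurable_set1|exact: lebesgue_measure_set1|].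
  by move=> t /= /negP; rewrite negbK => /eqP.
have FF := ae_filter_ringOfSetsType (@lebesgue_measure R).
move: (@filterI _ _ FF _ _ zd z0).
apply: (@filterS _ _ FF) => t [/= dt tN0] t0.
have {}dt : derivable z t 1 by apply: dt; rewrite lt_neqAle eq_sym tN0.
split=> // C hC cC cvxC; apply: closed_enormP => // r r0.
have r2 : 0 < r / 2 by rewrite divr_gt0.
have [t1 t10 Ht1] := euler_limit_quotient t0 cvxC hC r2.
have /cvg_enormP/(_ _ r2) := dt.
rewrite -/('D_1 z t) => -[t2 /= t20 Ht2].
pose u := Num.min t1 t2 / 2.
have u0 : 0 < u by rewrite divr_gt0// lt_min t10.
have [ut1 ut2] : u < t1 /\ u < t2.
  have := ge_min t1 t1 t2; have := ge_min t2 t1 t2; rewrite !lexx orbT /= /u.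
  by split; lra.
have [|w Cw wr] := Ht1 u; first by rewrite u0.
exists w => //.
have : enorm (u^-1 *: (z (u *: 1 + t) - z t) - 'D_1 z t) < r / 2.
  by apply: Ht2; rewrite ?gt_eqF//= sub0r normrN gtr0_norm.
rewrite [u *: 1]mulr1 (addrC u) => Du.
have := enorm_dist_trans (u^-1 *: (z (t + u) - z t)) ('D_1 z t) w.
by rewrite (enorm_distC ('D_1 z t) (_ *: _)); lra.
Qed.

End limit.
End euler_scheme.

(** * Stability over one block *)

Section block_stability.
Context {R : realType} {d : nat} {S : pseudoMetricType R}.
Variables (h : 'rV[R]_d -> S -> 'rV[R]_d) (L : R).

(** Beyond [N] the scheme goes on with step [e] and no noise, so its time is unbounded and the limit
    is defined on the whole half-line. *)
Lemma euler_scheme_extend c e N (a : nat -> R) (v E : nat -> 'rV[R]_d) (s : nat -> S) :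
  0 < e -> 1 <= c -> (forall k, (k < N)%N -> 0 < a k <= e) ->
  (forall k, (k <= N)%N -> enorm (E k) <= e) -> enorm (v 0%N) <= 1 ->
  (forall k, (k < N)%N -> v k.+1 = v k + a k *: hc h c (v k + E k) (s k)) ->
  exists a' v' E', [/\ euler_scheme h c e a' v' E' s,
    (forall t, exists k, t < series a' k),
    series a' N = series a N, v' N = v N & E' N = E N].
Proof.
move=> e0 c1 a0 Ee v0 vS.
pose a' k := if (k < N)%N then a k else e.
pose E' k := if (k <= N)%N then E k else 0.
pose fix v' k := if k is k'.+1 then v' k' + a' k' *: hc h c (v' k' + E' k') (s k')
                 else v 0%N.
exists a', v', E'; split.
- split=> // k; rewrite /a' /E'; case: ifPn => // kN.
  + exact: a0.
  + by rewrite e0 lexx.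
  + exact: Ee.
  + by rewrite enorm0 ltW.
- move=> t; exists (N + Num.bound (`|t| / e))%N.
  have -> : series a' (N + Num.bound (`|t| / e))%N =
      series a' N + e * (Num.bound (`|t| / e))%:R.
    elim: (Num.bound _) => [|m IH]; first by rewrite addn0 mulr0 addr0.
    rewrite addnS seriesSr IH {2}/a' ltnNge leq_addr/= -addrA; congr (_ + _).
    by rewrite -natr1 mulrDr mulr1.
  rewrite (@lt_le_trans _ _ (e * (Num.bound (`|t| / e))%:R))//.
    rewrite mulrC -ltr_pdivrMr// (le_lt_trans _ (archi_boundP _)) ?divr_ge0 ?(ltW e0)//.
    by rewrite ler_pM2r ?invr_gt0// ler_norm.
  rewrite lerDr /series/= big_nat sumr_ge0// => k /= kN.
  by rewrite /a' kN ltW//; have /andP[] := a0 _ kN.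
- by rewrite /series/= !big_nat; apply: eq_bigr => k /= kN; rewrite /a' kN.
- suff H k : (k <= N)%N -> v' k = v k by exact: H.
  elim: k => //= k IH kN; rewrite IH 1?ltnW// vS// /a' /E' kN.
  by rewrite ltnW.
- by rewrite /E' leqnn.
Qed.

Hypothesis cS : compact [set: S].
Hypothesis hcont : continuous (fun p : 'rV[R]_d * S => h p.1 p.2).
Hypothesis L0 : 0 < L.
Hypothesis hL : forall x1 x2 s, enorm (h x1 s - h x2 s) <= L * enorm (x1 - x2).

Lemma euler_block_stable : S1 h -> S2 h -> exists T e c0 : R,
  [/\ 0 < T, 0 < e, 1 <= c0 &
   forall c N (a : nat -> R) (v E : nat -> 'rV[R]_d) (s : nat -> S), c0 <= c ->
   (forall k, (k < N)%N -> 0 < a k <= e) -> T <= series a N <= T + 1 ->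
   (forall k, (k <= N)%N -> enorm (E k) <= e) -> enorm (v 0%N) <= 1 ->
   (forall k, (k < N)%N -> v k.+1 = v k + a k *: hc h c (v k + E k) (s k)) ->
   enorm (v N + E N) <= 1].
Proof.
move=> hS1 [A [V [[_ _ attr] [r r1 Ar] V1]]].
(* This neighborhood of [A] stays in the open unit ball, since [r + (1 - r) / 2 < 1]. *)
have eps0 : 0 < (1 - r) / 2 by rewrite divr_gt0// subr_gt0.
have [T0 [_ T0P]] := attr _ eps0.
pose T := Num.max T0 1.
have T_gt0 : 0 < T by rewrite lt_max ltr01 orbT.
apply: contrapT => abs.
(* The counterexample of index [p] has scale at least [p + 1], and steps and noise at most
   [1 / (p + 1)]. *)
pose eps (p : nat) : R := p.+1%:R^-1.
have eps_gt0 p : 0 < eps p by rewrite invr_gt0.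
have eps1 p : eps p <= 1 by rewrite invf_le1// ler1n.
have {}abs (p : nat) :
    exists q : (R * nat) * ((nat -> R) * (nat -> 'rV[R]_d) * (nat -> 'rV[R]_d) * (nat -> S)),
    [/\ p.+1%:R <= q.1.1,
      euler_scheme h q.1.1 (eps p) q.2.1.1.1 q.2.1.1.2 q.2.1.2 q.2.2,
      forall t, exists k, t < series q.2.1.1.1 k,
      T <= series q.2.1.1.1 q.1.2 <= T + 1 &
      1 < enorm (q.2.1.1.2 q.1.2 + q.2.1.2 q.1.2)].
  apply: contrapT => nex; apply: abs; exists T, (eps p), p.+1%:R; split => //.
    by rewrite ler1n.
  move=> c N a v E s pc a0 aT Ee v0 vS; rewrite leNgt; apply/negP => vN.
  have c1 : 1 <= c by rewrite (le_trans _ pc)// ler1n.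
  have [a' [v' [E' [sch ub aN vN' EN]]]] :=
    euler_scheme_extend (eps_gt0 p) c1 a0 Ee v0 vS.
  by apply: nex; exists (c, N, (a', v', E', s)); split => //=; rewrite ?aN ?vN' ?EN.
have {abs} [f fP] := choice abs.
pose c p := (f p).1.1; pose N p := (f p).1.2; pose a p := (f p).2.1.1.1.
pose v p := (f p).2.1.1.2; pose E p := (f p).2.1.2; pose s p := (f p).2.2.
have sch p : euler_scheme h (c p) (eps p) (a p) (v p) (E p) (s p) by have [] := fP p.
have aT p : T <= series (a p) (N p) <= T + 1 by have [] := fP p.
have vN p : 1 < enorm (v p (N p) + E p (N p)) by have [] := fP p.
have [b b0 hb] := h0_bounded cS hcont.
have [U UU Ucof] := ultra_nat_exists.
have c_large C : U [set p | C <= c p].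
  apply: filterS (Ucof (Num.bound `|C|)) => p /= Cp.
  have [pc _ _ _ _] := fP p; rewrite (le_trans _ pc)// (le_trans (ler_norm _))//.
  by rewrite (le_trans (ltW (archi_boundP _)))// ler_nat ltnW.
have e_small q : 0 < q -> U [set p | eps p < q].
  move=> q0; apply: filterS (Ucof (Num.bound q^-1)) => p /= qp.
  rewrite /eps invf_plt ?posrE// (lt_le_trans (archi_boundP _)) ?invr_ge0 ?(ltW q0)//.
  by rewrite ler_nat ltnW.
(* A choice function needs a value everywhere: negative times get the default index 0, and later the
   default limit 0. *)
have /choice[kap kapP] (q : nat * R) :
    exists k, 0 <= q.2 -> series (a q.1) k <= q.2 < series (a q.1) k.+1.
  have [q0|] := leP 0 q.2; last by exists 0%N.
  by have [_ _ ub _ _] := fP q.1; have [k kP] := euler_index (ub q.2) q0; exists k.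
pose kp p t := kap (p, t).
have kpP p t : 0 <= t -> series (a p) (kp p t) <= t < series (a p) (kp p t).+1.
  by move=> t0; exact: (kapP (p, t) t0).
have /choice[z zlim] t : exists l, 0 <= t -> forall q, 0 < q ->
    U [set p | enorm (v p (kp p t) - l) < q].
  have [t0|] := leP 0 t; last by exists 0.
  have [|l lP] := @ultra_enorm_lim R d _ U _ (fun p => v p (kp p t)) (euler_bound L b t).
    apply: filterE => p /=.
    rewrite (le_trans (euler_scheme_bound L0 hL b0 hb (sch p) (eps1 p) _))//.
    by apply: euler_bound_le => //; have /andP[] := kpP p t t0.
  by exists l.
have zsol := euler_limit_solution L0 hL b0 hb hS1 cS hcont UU sch eps1 c_large
  e_small kpP zlim.
have z0 : enorm (z 0) <= 1.
  apply/ler_addgt0Pr => q q0.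
  have [p /= pq] := filter_ex (zlim 0 (lexx _) _ q0).
  have kp0 : kp p 0 = 0%N.
    have /andP[k0 _] := kpP p 0 (lexx _).
    apply/eqP; rewrite -leqn0 -ltnS; apply: (euler_time_lt_inv (sch p)).
    by rewrite (le_lt_trans k0)// /series/= big_nat1 (euler_step_gt0 (sch p)).
  rewrite kp0 in pq; have [_ _ _ v0 _] := sch p.
  by have := enorm_leD (z 0) (v p 0%N); rewrite enorm_distC; lra.
(* The block durations vary with [p] within [[T, T + 1]]; [th] is their limit along [U]. *)
have [th thT Uth] := @ultra_compact_lim _ U _ R _ (fun p => series (a p) (N p))
  (@segment_compact _ T (T + 1)) (filterE _ aT).
have {thT} /andP[Tth thT] : T <= th <= T + 1 by move: thT; rewrite /= in_itv.
have th0 : 0 <= th by rewrite (le_trans (ltW T_gt0)).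
have [u Au zu] : Neps A ((1 - r) / 2) (z th).
  apply: (T0P th (z 0)); [|exact: V1|by exists z].
  by rewrite (le_trans _ Tth)// le_max lexx.
have zth : enorm (z th) < 1.
  by have := enorm_leD (z th) u; have := Ar _ Au; lra.
have B0 := euler_speed_ge0 L0 b0 (T + 1); set B := euler_speed L b (T + 1) in B0 *.
(* Three errors of at most [q] each: from [z th] to the scheme, from [kap p th] to [N p], and the
   noise. Their sum stays below the gap to 1. *)
pose q := (1 - enorm (z th)) / 4.
have q0 : 0 < q by rewrite divr_gt0// subr_gt0.
pose q' := q / 2 / (B + 1).
have B1 : 0 < B + 1 by rewrite ltr_wpDl.
have q'0 : 0 < q' by rewrite divr_gt0// divr_gt0.
have Uth' : U [set p | `|th - series (a p) (N p)| < q'].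
  have /cvgrPdist_lt/(_ _ q'0) := Uth; exact.
have [p [/= pz [pth [pe1 pe2]]]] := filter_ex (filterI (zlim th th0 _ q0)
  (filterI Uth' (filterI (e_small _ q0) (e_small _ q'0)))).
have := vN p; apply/negP; rewrite -leNgt.
have /andP[k1 k2] := kap_time sch kpP p th0.
have vNk : enorm (v p (N p) - v p (kp p th)) <= q.
  have tk : `|series (a p) (N p) - series (a p) (kp p th)| <= q / (B + 1).
    have -> : q / (B + 1) = q' + q' by rewrite /q'; field; rewrite gt_eqF.
    by move: pth; rewrite ltr_norml ler_norml; lra.
  have Bq x : x <= q / (B + 1) -> B * x <= q.
    move=> xq; rewrite (le_trans (ler_wpM2l B0 xq))// mulrCA ler_piMr ?(ltW q0)//.
    by rewrite ler_pdivrMr// mul1r lerDl.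
  have /andP[_ NT] := aT p.
  case: (leqP (kp p th) (N p)) => [kN|/ltnW Nk].
    rewrite (le_trans (euler_incr_le L0 hL b0 hb (sch p) (eps1 p) kN NT))//.
    by rewrite Bq// (le_trans (ler_norm _)).
  rewrite enorm_distC.
  rewrite (le_trans (euler_incr_le L0 hL b0 hb (sch p) (eps1 p) Nk (le_trans k1 thT)))//.
  by rewrite Bq// (le_trans (ler_norm _))// distrC.
have [_ _ /(_ (N p)) Ee _ _] := sch p.
have := enormD (v p (N p)) (E p (N p)).
have := enorm_leD (v p (N p)) (v p (kp p th)).
have := enorm_leD (v p (kp p th)) (z th).
rewrite /q in q0 vNk pz pe1 *; lra.
Qed.

End block_stability.

(** * Integration against a sub-sigma-algebra *)

Section sub_sigma_algebra.
Context {R : realType} {dO : measure_display} {Omega : measurableType dO}.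
Variable G : set (set Omega).
Hypothesis sG : @sigma_algebra Omega setT G.

Lemma sub_sigma_setC A : G A -> G (~` A).
Proof. by move=> GA; rewrite -setTD; have [_ + _] := sG; exact. Qed.

Lemma sub_sigma_setT : G setT.
Proof. by rewrite -setC0; apply: sub_sigma_setC; have [] := sG. Qed.

Lemma sub_sigma_setU A B : G A -> G B -> G (A `|` B).
Proof.
move=> GA GB; rewrite -bigcup2E; have [G0 _] := sG; apply.
by move=> [|[|n]].
Qed.

Lemma sub_sigma_setI A B : G A -> G B -> G (A `&` B).
Proof.
move=> GA GB; rewrite -[A]setCK -[B]setCK -setCU; apply: sub_sigma_setC.
by apply: sub_sigma_setU; exact: sub_sigma_setC.
Qed.

Lemma G_meas_cst (T : topologicalType) (t : T) : G_meas G (fun=> t).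
Proof.
move=> V oV; have [Vt|Vt] := pselect (V t).
  by rewrite (_ : _ @^-1` _ = setT) ?predeqE//; exact: sub_sigma_setT.
by rewrite (_ : _ @^-1` _ = set0); [have [] := sG|rewrite predeqE].
Qed.

Lemma G_meas_comp (T W : topologicalType) (f : T -> W) (X : Omega -> T) :
  continuous f -> G_meas G X -> G_meas G (f \o X).
Proof.
by move=> cf GX V oV; rewrite comp_preimage; apply: GX; move/continuousP : cf; exact.
Qed.

Lemma G_meas_if (T : topologicalType) (B : pred Omega) (X Y : Omega -> T) :
  G [set w | B w] -> G_meas G X -> G_meas G Y ->
  G_meas G (fun w => if B w then X w else Y w).
Proof.
move=> GB GX GY V oV.
rewrite (_ : _ @^-1` _ = ([set w | B w] `&` X @^-1` V) `|`
                         (~` [set w | B w] `&` Y @^-1` V)).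
  apply: sub_sigma_setU; apply: sub_sigma_setI => //; last exact: GY.
    exact: GX.
  exact: sub_sigma_setC.
rewrite predeqE => w /=; case: ifPn => [Bw|/negP Bw].
  by split=> [Xw|[[]//|[]//]]; left.
by split=> [Yw|[[]//|[]//]]; right.
Qed.

Lemma rat_vector_dense d (x : 'rV[R]_d) (e : R) : 0 < e ->
  exists q : 'rV[rat]_d, ball (map_mx ratr q : 'rV[R]_d) e x.
Proof.
move=> e0; have /choice[q qP] (j : 'I_d) : exists q : rat, `|ratr q - x 0 j| < e.
  have [|q] := @rat_in_itvoo R (x 0 j - e) (x 0 j + e); first by lra.
  by rewrite in_itv/= => qe; exists q; rewrite ltr_norml; lra.
exists (\row_j q j); split => // i j; rewrite (ord1 i) !mxE.
exact: qP.
Qed.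

(* Only the first factor needs a countable base. *)
Lemma G_meas_pair d (T W : topologicalType) (f : 'rV[R]_d * T -> W)
    (X : Omega -> 'rV[R]_d) (Y : Omega -> T) :
  continuous f -> G_meas G X -> G_meas G Y -> G_meas G (fun w => f (X w, Y w)).
Proof.
move=> cf GX GY V oV.
have oO : open (f @^-1` V) by move/continuousP : cf; exact.
(* The open preimage is a countable union of rectangles [Bq q] times [Vq q], with rational centers
   and radii [1 / (k + 1)]; codes that decode to nothing contribute the empty set. *)
pose Bq (q : 'rV[rat]_d * nat) : set 'rV[R]_d :=
  ball (map_mx ratr q.1 : 'rV[R]_d) q.2.+1%:R^-1.
pose Vq q : set T := interior [set t | forall x, Bq q x -> V (f (x, t))].
pose F n := if @unpickle ('rV[rat]_d * nat)%type n is Some q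
            then X @^-1` Bq q `&` Y @^-1` Vq q else set0.
rewrite (_ : _ @^-1` _ = \bigcup_n F n).
  have [G0 _] := sG; apply => n; rewrite /F; case: unpickle => // q.
  by apply: sub_sigma_setI; [apply: GX; exact: ball_open|apply: GY; exact: open_interior].
rewrite predeqE => w; split=> [Vw|[n _]]; last first.
  by rewrite /F; case: unpickle => // q [/= Xw /interior_subset]; apply.
have /= : nbhs (X w, Y w) (f @^-1` V) by apply: open_nbhs_nbhs.
move=> [[A B] /= [AX BY] AB].
have [e /= e0 eA] := (nbhs_ballP _ _).1 AX.
have [k ke] : exists k : nat, k.+1%:R^-1 < e / 2.
  have e20 : 0 < e / 2 by rewrite divr_gt0.
  have [k _ /(_ k (leqnn _)) /= ke] := near_infty_natSinv_lt (PosNum e20).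
  by exists k.
have k0 : 0 < k.+1%:R^-1 :> R by rewrite invr_gt0.
have [q qX] := rat_vector_dense (X w) k0.
exists (pickle (q, k)) => //; rewrite /F pickleK; split => //=.
rewrite /Vq /interior /=; apply: filterS BY => t Bt x Bx.
apply: (AB (x, t)); split => //=; apply: eA.
apply: (@ball_splitr _ _ (map_mx ratr q : 'rV[R]_d)).
  by apply: le_ball (ltW ke) _ _.
by apply: le_ball (ltW ke) _ _.
Qed.

Hypothesis Gm : G `<=` measurable.

Lemma G_meas_measurable (X : Omega -> R) : G_meas G X -> measurable_fun setT X.
Proof.
move=> GX; apply: (measurability _ (RGenOInfty.measurableE R)) => //.
move=> _ [_ [a ->] <-]; rewrite setTI; apply: Gm; apply: GX.
exact: interval_open.
Qed.

Variable P : probability Omega R.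

Lemma integrable_bounded_mul (X Y : Omega -> R) (b : R) :
  measurable_fun setT Y -> (forall w, `|Y w| <= b) ->
  P.-integrable setT (EFin \o X) ->
  P.-integrable setT (EFin \o (fun w => Y w * X w)).
Proof.
move=> mY Yb iX.
have -> : EFin \o (fun w => Y w * X w) = ((EFin \o Y) \* (EFin \o X))%E by [].
apply: integrableMr => //; exists b; split; first exact: num_real.
by move=> c bc w _ /=; rewrite (le_trans (Yb w))// ltW.
Qed.

Lemma integrable_cst_prob (c : R) : P.-integrable setT (EFin \o (fun=> c)).
Proof.
apply: measurable_bounded_integrable => //=.
  by rewrite probability_setT ltry.
by exists `|c|; split; [exact: num_real|move=> x cx w _ /=; exact: ltW].
Qed.

Lemma Rintegral_cst_prob (c : R) : \int[P]_w c = c.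
Proof.
transitivity (c * fine (P setT)); first exact: Rintegral_cst.
by rewrite probability_setT mulr1.
Qed.

(** The function [Num.max (X w) c] dominates [X] everywhere and equals [c] almost everywhere. *)
Lemma ae_le_Rintegral_cst (X : Omega -> R) (c : R) :
  P.-integrable setT (EFin \o X) -> {ae P, forall w, X w <= c} ->
  \int[P]_w X w <= c.
Proof.
move=> iX Xc; have mX : measurable_fun setT X by exact/measurable_EFinP/(measurable_int P).
have mXc : measurable_fun setT (fun w => Num.max (X w) c).
  by apply: measurable_maxr => //; exact: measurable_cst.
have eXc : ae_eq P setT (EFin \o (fun w => Num.max (X w) c)) (EFin \o (fun=> c)).
  by apply: filterS Xc => w Xw _ /=; rewrite max_r.
have iXc : P.-integrable setT (EFin \o (fun w => Num.max (X w) c)).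
  apply: (le_integrable measurableT _ _ (integrableD measurableT
    (integrable_norm iX) (integrable_cst_prob `|c|))); first exact/measurable_EFinP.
  move=> w _ /=; rewrite lee_fin (ger0_norm (x := _ + _)) ?addr_ge0//.
  by case: (leP (X w) c) => _; rewrite ?lerDl ?lerDr.
rewrite -[leRHS]Rintegral_cst_prob.
rewrite (@le_trans _ _ (\int[P]_w Num.max (X w) c))//.
  by apply: le_Rintegral => // w _; rewrite le_max lexx.
rewrite le_eqVlt; apply/orP; left; apply/eqP; congr fine.
by apply: ae_eq_integral eXc => //; exact/measurable_EFinP.
Qed.

Lemma Rintegral_sum_prob (I : Type) (r : seq I) (f : I -> Omega -> R) :
  (forall i, P.-integrable setT (EFin \o f i)) ->
  P.-integrable setT (EFin \o (fun w => \sum_(i <- r) f i w)) /\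
  \int[P]_w (\sum_(i <- r) f i w) = \sum_(i <- r) \int[P]_w f i w.
Proof.
move=> fi; elim: r => [|i r [IH1 IH2]].
  rewrite big_nil; under eq_Rintegral do rewrite big_nil.
  rewrite Rintegral_cst_prob; split => //.
  by under eq_fun do rewrite big_nil; exact: integrable_cst_prob.
rewrite big_cons; under eq_Rintegral do rewrite big_cons.
split; last by rewrite RintegralD// IH2.
have := integrableD measurableT (fi i) IH1; apply: eq_integrable => // w _.
by rewrite /= big_cons.
Qed.

(** The sum is the integer part of [z], written as a combination of indicators of level sets. *)
Lemma count_le_dist (N : nat) (z : R) : 0 <= z <= N%:R ->
  `|z - \sum_(i < N) (i.+1%:R <= z)%R%:R| <= 1.
Proof.
elim: N => [|N IH] /andP[z0 zN].
  by rewrite big_ord0 subr0 ger0_norm// (le_trans zN).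
rewrite big_ord_recr/=; have [zN'|zN'] := leP z N%:R.
  have /negbTE -> : ~~ (N.+1%:R <= z).
    by rewrite -ltNge (le_lt_trans zN')// ltr_nat.
  by rewrite addr0 IH// z0.
rewrite (eq_bigr (fun=> 1)) => [|i _]; last first.
  by rewrite (le_trans _ (ltW zN'))// ler_nat.
rewrite sumr_const card_ord; move: zN; rewrite -natr1 => zN.
by rewrite ler_norml; case: (leP (N%:R + 1) z) => _ /=; lra.
Qed.

(** Scaled by [n + 1], the factor [Y] is within 1 of a finite sum of indicators of sets in [G], up
    to a constant; against these [X] integrates to 0. The bound by the integral of [|X|] for every
    [n] forces 0. *)
Lemma Rintegral_mul_centered (X Y : Omega -> R) (b : R) :
  P.-integrable setT (EFin \o X) -> (forall B, G B -> \int[P]_(w in B) X w = 0) ->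
  G_meas G Y -> (forall w, `|Y w| <= b) -> \int[P]_w (Y w * X w) = 0.
Proof.
move=> iX X0 GY Yb.
have mY := G_meas_measurable GY; have iYX := integrable_bounded_mul mY Yb iX.
have b0 : 0 <= b by exact: le_trans (normr_ge0 _) (Yb point).
suff H n : n.+1%:R * `|\int[P]_w (Y w * X w)| <= \int[P]_w `|X w|.
  apply/eqP; rewrite -normr_le0 leNgt; apply/negP => I0.
  set J := \int[P]_w `|X w| in H; set I := `|_| in H I0.
  have J0 : 0 <= J by apply: Rintegral_ge0 => w _.
  have := H (Num.bound (J / I)); apply/negP; rewrite -ltNge -ltr_pdivrMr//.
  rewrite (lt_trans (archi_boundP _)) ?divr_ge0 ?(ltW I0)//.
  by rewrite ltr_nat.
(* Adding [b] makes [z] nonnegative and leaves the integral unchanged, because [X] has total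
   integral 0. *)
pose N := Num.bound (n.+1%:R * (b + b)); pose z w := (Y w + b) * n.+1%:R.
have zN w : 0 <= z w <= N%:R.
  have := Yb w; rewrite ler_norml => Yw; rewrite mulr_ge0//=; last by lra.
  apply: (le_trans _ (ltW (archi_boundP _))); last by rewrite mulr_ge0// addr_ge0.
  by rewrite /z mulrC ler_wpM2l//; lra.
pose A (i : nat) := [set w | i.+1%:R <= z w].
have GA i : G (A i).
  rewrite -(setCK (A i)); apply: sub_sigma_setC.
  rewrite (_ : ~` A i = Y @^-1` [set y | (y + b) * n.+1%:R < i.+1%:R]).
    apply: GY; rewrite (_ : [set y | _] = [set y : R | y < i.+1%:R / n.+1%:R - b]).
      exact: open_lt.
    by rewrite predeqE => y /=; rewrite ltrBrDr ltr_pdivlMr.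
  by rewrite predeqE => w; rewrite /A /= -/(z w) ltNge; split => /negP.
have mA i : measurable (A i) by exact/Gm.
have iA i : P.-integrable setT (EFin \o (fun w => (i.+1%:R <= z w)%R%:R * X w)).
  apply: (@integrable_bounded_mul X (fun w => (i.+1%:R <= z w)%R%:R) 1) => //.
    rewrite (_ : (fun w => _) = \1_(A i)); first exact: measurable_indic.
    apply/funext => w; rewrite indicE; congr (_%:R); congr nat_of_bool.
    by apply/idP/idP => [|/set_mem //]; move=> Aw; exact/mem_set.
  by move=> w; rewrite normr_nat lern1 leq_b1.
have intA i : \int[P]_w ((i.+1%:R <= z w)%R%:R * X w) = 0.
  rewrite -[RHS](X0 _ (GA i)) [RHS]Rintegral_mkcond.
  apply: eq_Rintegral => w _.
  rewrite patchE; case: ifPn => [/set_mem -> |]; first by rewrite mul1r.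
  move=> /negP Aw; case: (boolP (_ <= _)); last by rewrite mul0r.
  by move=> zw; exfalso; apply: Aw; exact/mem_set.
have [iQ intQ] := Rintegral_sum_prob (index_enum 'I_N) (fun i : 'I_N => iA i).
rewrite big1 in intQ; last by [].
have iz : P.-integrable setT (EFin \o (fun w => z w * X w)).
  apply: (@integrable_bounded_mul X z N%:R) => //.
    apply: measurable_funM => //; apply: measurable_funD => //.
  by move=> w; have /andP[z0 zw] := zN w; rewrite ger0_norm.
have inY : P.-integrable setT (EFin \o (fun w => n.+1%:R * (Y w * X w))).
  by have := integrableZl measurableT (n.+1%:R : R) iYX; apply: eq_integrable.
have intz : \int[P]_w (z w * X w) = n.+1%:R * \int[P]_w (Y w * X w).
  rewrite -RintegralZl//; apply/eqP; rewrite -subr_eq0 -RintegralB//; apply/eqP.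
  transitivity (\int[P]_w ((b * n.+1%:R) * X w)).
    by apply: eq_Rintegral => w _; rewrite /z; ring.
  by rewrite RintegralZl// X0 ?mulr0//; exact: sub_sigma_setT.
rewrite -[n.+1%:R]ger0_norm// -normrM -intz -[X in `|X|]subr0 -[X in _ - X]intQ.
rewrite -RintegralB//.
have iB : P.-integrable setT (EFin \o (fun w => z w * X w -
    \sum_(i <- index_enum 'I_N) (i.+1%:R <= z w)%R%:R * X w)).
  exact: (integrableB measurableT iz iQ).
rewrite (le_trans (le_normr_Rintegral _ iB))//; apply: le_Rintegral => //.
- exact: integrable_norm.
- exact: integrable_norm.
- move=> w _; rewrite -mulr_suml -mulrBl normrM ler_piMl//.
  exact: count_le_dist.
Qed.

End sub_sigma_algebra.

(** * A maximal inequality *)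

Section frozen_sum.
Context {R : realType} {d : nat} {dO : measure_display} {Omega : measurableType dO}.
Variables (P : probability Omega R) (F : nat -> set (set Omega)).
Variables (D : nat -> Omega -> 'rV[R]_d) (g : nat -> Omega -> R) (r : R).

(* After freezing, the last partial sum still records whether an earlier one
   reached [r]. *)
Fixpoint frozen_sum n w : 'rV[R]_d :=
  if n is n'.+1 then
    frozen_sum n' w + (if enorm (frozen_sum n' w) < r then g n' w else 0) *: D n' w
  else 0.

Lemma frozen_sum_stop n m w : (n <= m)%N -> r <= enorm (frozen_sum n w) ->
  frozen_sum m w = frozen_sum n w.
Proof.
move=> nm nr; elim: m nm => [|m IH]; first by rewrite leqn0 => /eqP ->.
rewrite leq_eqVlt => /predU1P[<-//|]; rewrite ltnS => /IH /= ->.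
by rewrite ltNge nr /= scale0r addr0.
Qed.

Hypothesis hF : filtration F.
Hypothesis Dm : forall i, G_meas (F i.+1) (D i).
Hypothesis D2 : forall i, P.-integrable setT (EFin \o (fun w => enorm (D i w) ^+ 2)).
Hypothesis D0 : forall i j B, F i B -> \int[P]_(w in B) D i w 0 j = 0.
Hypothesis gm : forall i, G_meas (F i) (g i).
Hypothesis g1 : forall i w, `|g i w| <= 1.
Variable sigma : nat -> R.
Hypothesis gD : forall i, \int[P]_w (g i w ^+ 2 * enorm (D i w) ^+ 2) <= sigma i.
Hypothesis r0 : 0 < r.

Lemma filtration_le i j : (i <= j)%N -> F i `<=` F j.
Proof.
move=> ij; elim: j ij => [|j IH]; first by rewrite leqn0 => /eqP ->.
rewrite leq_eqVlt => /predU1P[<-//|]; rewrite ltnS => /IH /subset_trans; apply.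
by have [] := hF j.
Qed.

Lemma G_meas_filtration_le i j (T : topologicalType) (X : Omega -> T) :
  (i <= j)%N -> G_meas (F i) X -> G_meas (F j) X.
Proof. by move=> ij GX V oV; apply: (filtration_le ij); exact: GX. Qed.

Let sF i : @sigma_algebra Omega setT (F i). Proof. by have [] := hF i. Qed.
Let Fm i : F i `<=` measurable. Proof. by have [] := hF i. Qed.

Lemma add_continuous_pair : continuous (fun p : 'rV[R]_d * 'rV[R]_d => p.1 + p.2).
Proof. by move=> p; apply: cvgD; [exact: cvg_fst|exact: cvg_snd]. Qed.

Lemma scale_continuous_pair : continuous (fun p : 'rV[R]_d * R => p.2 *: p.1).
Proof. by move=> p; apply: cvgZ; [exact: cvg_snd|exact: cvg_fst]. Qed.

Lemma coord_continuous_pair j : continuous (fun p : 'rV[R]_d * R => p.2 * p.1 0 j).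
Proof.
move=> p; apply: cvgM; first exact: cvg_snd.
apply: (@cvg_comp _ _ _ fst (fun v : 'rV[R]_d => v 0 j) _ (nbhs p.1)).
  exact: cvg_fst.
exact: coord_continuous.
Qed.

Let k n w := if enorm (frozen_sum n w) < r then g n w else 0.

Lemma frozen_factor_meas n : G_meas (F n) (frozen_sum n) -> G_meas (F n) (k n).
Proof.
move=> GV; apply: G_meas_if => //; last exact: G_meas_cst.
exact: (G_meas_comp (@enorm_continuous R d) GV (@open_lt _ r)).
Qed.

Lemma frozen_sum_meas n : G_meas (F n) (frozen_sum n).
Proof.
elim: n => [|n IH]; first exact: G_meas_cst.
apply: (@G_meas_pair _ _ _ _ (sF _) _ _ _ (fun p => p.1 + p.2) _
  (fun w => k n w *: D n w) add_continuous_pair).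
  exact: G_meas_filtration_le IH.
have km := G_meas_filtration_le (leqnSn n) (frozen_factor_meas IH).
by have := G_meas_pair (sF _) scale_continuous_pair (Dm n) km.
Qed.

(** Orthogonality of increments: [k n] times the partial sum is known at time [n] and, thanks to the
    freezing, bounded by [r], so the cross term integrates to 0. *)
Lemma frozen_sum_sqr n :
  P.-integrable setT (EFin \o (fun w => enorm (frozen_sum n w) ^+ 2)) /\
  \int[P]_w (enorm (frozen_sum n w) ^+ 2) <= \sum_(i < n) sigma i.
Proof.
elim: n => [|n [IH1 IH2]].
  rewrite (_ : (fun w => _) = fun=> 0); last first.
    by apply/funext => w /=; rewrite enorm0 expr0n.
  by rewrite Rintegral_cst_prob big_ord0; split=> //; exact: integrable_cst_prob.
have kg w : `|k n w| <= 1 by rewrite /k; case: ifP; rewrite ?normr0.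
have km := frozen_factor_meas (frozen_sum_meas n).
have kVm j : G_meas (F n) (fun w => k n w * frozen_sum n w 0 j).
  by have := G_meas_pair (sF n) (@coord_continuous_pair j) (@frozen_sum_meas n) km.
have kVb j w : `|k n w * frozen_sum n w 0 j| <= r.
  rewrite /k; case: ifPn => [Vr|_]; last by rewrite mul0r normr0 ltW.
  rewrite normrM (le_trans (ler_piMl _ (g1 n w)))//.
  exact: le_trans (coord_le_enorm _ _) (ltW Vr).
(* Integrability comes from [t <= 1 + t ^+ 2]. *)
have Dj j : P.-integrable setT (EFin \o (fun w => D n w 0 j)).
  have mD : measurable_fun setT (fun w => D n w 0 j).
    apply: (@G_meas_measurable _ _ _ (F n.+1)) => //.
    exact: (G_meas_comp (@coord_continuous _ _ _ 0 j) (Dm n)).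
  apply: (le_integrable measurableT _ _ (integrableD measurableT
    (integrable_cst_prob P 1) (D2 n))); first exact/measurable_EFinP.
  move=> w _ /=; rewrite lee_fin (ger0_norm (x := _ + _)) ?addr_ge0 ?sqr_ge0//.
  rewrite (le_trans (coord_le_enorm _ _))//; have := sqr_ge0 (enorm (D n w) - 1); nra.
pose c j w := (k n w * frozen_sum n w 0 j) * D n w 0 j.
have ic j : P.-integrable setT (EFin \o c j).
  by apply: integrable_bounded_mul (kVb j) (Dj j); exact: G_meas_measurable (kVm j).
have [iC intC] := Rintegral_sum_prob (index_enum 'I_d) ic.
rewrite big1 in intC => [|j _]; last first.
  by apply: (Rintegral_mul_centered (sF n) (@Fm n) (Dj j) _ (kVm j) (kVb j)) => B FB; exact: D0.
have ik2 (u : Omega -> R) : G_meas (F n) u -> (forall w, `|u w| <= 1) ->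
    P.-integrable setT (EFin \o (fun w => u w ^+ 2 * enorm (D n w) ^+ 2)).
  move=> Gu u1; apply: (@integrable_bounded_mul _ _ _ P _ (fun w => u w ^+ 2) 1).
  - by apply: measurable_funX; exact: G_meas_measurable Gu.
  - by move=> w; rewrite normrX exprn_ile1.
  - exact: D2.
have E w : enorm (frozen_sum n.+1 w) ^+ 2 = enorm (frozen_sum n w) ^+ 2 +
    (2 * \sum_(j <- index_enum 'I_d) c j w + k n w ^+ 2 * enorm (D n w) ^+ 2).
  rewrite /= -/(k n w) enorm_sqrD enormZ exprMn real_normK ?num_real// -addrA.
  congr (_ + (_ + _)); rewrite mulr_natl; congr (_ *+ 2).
  by apply: eq_bigr => j _; rewrite mxE /c; ring.
have i2C : P.-integrable setT (EFin \o (fun w => 2 * \sum_(j <- index_enum 'I_d) c j w)).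
  by have := integrableZl measurableT (2 : R) iC; apply: eq_integrable.
have ik := ik2 _ km kg; have ig := ik2 _ (gm n) (g1 n).
have iS : P.-integrable setT (EFin \o (fun w => 2 * \sum_(j <- index_enum 'I_d) c j w
    + k n w ^+ 2 * enorm (D n w) ^+ 2)).
  exact: (integrableD measurableT i2C ik).
split.
  have := integrableD measurableT IH1 iS; apply: eq_integrable => // w _.
  by rewrite /= -/(frozen_sum n.+1 w) E.
under eq_Rintegral do rewrite E.
rewrite RintegralD// RintegralD// RintegralZl// intC mulr0 add0r big_ord_recr/=.
rewrite lerD// (le_trans _ (gD n))//; apply: le_Rintegral => // w _.
by rewrite ler_wpM2r ?sqr_ge0// /k; case: ifP => // _; rewrite expr0n sqr_ge0.
Qed.

Lemma frozen_sum_tail_measurable n : measurable [set w | r <= enorm (frozen_sum n w)].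
Proof.
rewrite (_ : [set w | _] = ~` [set w | enorm (frozen_sum n w) < r]).
  apply: measurableC; apply: (@Fm n).
  exact: (G_meas_comp (@enorm_continuous R d) (@frozen_sum_meas n) (@open_lt _ r)).
by rewrite predeqE => w /=; rewrite leNgt; split => /negP.
Qed.

(** Markov's inequality for the squared norm of the last sum; through the freezing it controls the
    maximum of all earlier ones. *)
Lemma frozen_sum_tail n : (P [set w | (r <= enorm (frozen_sum n w))%R] <=
  ((\sum_(i < n) sigma i) / r ^+ 2)%:E)%E.
Proof.
have mA := frozen_sum_tail_measurable n; set A := [set w | _] in mA *.
have [iV intV] := frozen_sum_sqr n.
rewrite -(@fineK _ (P A)) ?fin_num_measure// lee_fin ler_pdivlMr ?exprn_gt0//.
apply: (le_trans _ intV); rewrite mulrC -[leLHS]Rintegral_cst//.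
rewrite [leLHS]Rintegral_mkcond; apply: le_Rintegral => //.
  rewrite -restrict_EFin; apply/integrable_restrict => //; rewrite setTI.
  exact: integrableS (integrable_cst_prob P _).
move=> w _; rewrite patchE; case: ifPn => [/set_mem Aw|_]; last exact: sqr_ge0.
by rewrite ler_pXn2r// ?nnegrE ?enorm_ge0 ?ltW.
Qed.

End frozen_sum.

(** * The recursion over one block *)

(** From block [n0] on, [Q] bounds the block ends: values above [c0] do not increase, smaller ones
    grow to at most [C * c0]. The finitely many terms before are bounded by their sum. *)
Lemma blocks_bounded (R : realType) (be : nat -> R) (mm : nat -> nat) (C c0 : R) n0 :
  (forall k, 0 <= be k) -> 0 <= C -> 1 <= c0 -> (forall n, (mm n < mm n.+1)%N) ->
  (forall n k, (n0 <= n)%N -> (mm n <= k <= mm n.+1)%N ->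
     be k <= C * Num.max 1 (be (mm n))) ->
  (forall n, (n0 <= n)%N -> c0 <= be (mm n) -> be (mm n.+1) <= be (mm n)) ->
  exists B, forall k, be k <= B.
Proof.
move=> be0 C0 c1 mS bC bc.
pose Q := Num.max (be (mm n0)) (C * c0).
have bQ n : (n0 <= n)%N -> be (mm n) <= Q.
  elim: n => [|n IH]; first by rewrite leqn0 => /eqP <-; rewrite le_max lexx.
  rewrite leq_eqVlt => /predU1P[<-|]; first by rewrite le_max lexx.
  rewrite ltnS => n0n; have [cb|/ltW cb] := leP c0 (be (mm n)).
    exact: le_trans (bc _ n0n cb) (IH n0n).
  have := bC n (mm n.+1) n0n; rewrite leqnn (ltnW (mS n)) => /(_ isT) /le_trans; apply.
  by rewrite le_max; apply/orP; right; rewrite ler_wpM2l// ge_max c1.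
exists (\sum_(i < mm n0) be i + C * Num.max 1 Q) => k.
have CQ : 0 <= C * Num.max 1 Q by rewrite mulr_ge0// le_max ler01.
have [kn|nk] := ltnP k (mm n0).
  rewrite ler_wpDr// (bigD1 (Ordinal kn))//= lerDl sumr_ge0// => i _; exact: be0.
have mle n : (n <= mm n)%N by elim: n => // n /leq_ltn_trans; apply.
have mmono : {homo mm : i j / (i <= j)%N}.
  by apply: homo_leq => // [? ? ?|n]; [exact: leq_trans|exact: ltnW].
have ex : exists n, (k < mm n.+1)%N by exists k; exact: mle k.+1.
case: (ex_minnP ex) => n kn minn.
have n0n : (n0 <= n)%N.
  rewrite leqNgt; apply/negP => nn0; have := leq_trans kn (mmono _ _ nn0).
  by rewrite ltnNge nk.
have nk' : (mm n <= k)%N.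
  case: n kn minn n0n => [|n] kn minn n0n.
    by move: n0n nk; rewrite leqn0 => /eqP ->.
  by rewrite leqNgt; apply/negP => /minn; rewrite ltnn.
have := bC n k n0n; rewrite nk' (ltnW kn) => /(_ isT) /le_trans; apply.
rewrite ler_wpDl ?sumr_ge0//.
by rewrite ler_wpM2l// ge_max le_max lexx /= le_max bQ ?orbT.
Qed.

(** Stop at the first index whose time exceeds [T]; a step of at most 1 overshoots by at most 1. *)
Lemma block_length (R : realType) (a : nat -> R) (T : R) : 0 < T ->
  (forall n, 0 < a n) -> (forall n, a n <= 1) -> series a @ \oo --> +oo ->
  forall m, exists2 N, (0 < N)%N & T <= series (fun k => a (m + k)%N) N <= T + 1.
Proof.
move=> T0 a0 a1 aoo m.
have E N : series (fun k => a (m + k)%N) N = series a (m + N)%N - series a m.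
  elim: N => [|N IH]; first by rewrite addn0 subrr /series/= big_geq.
  by rewrite seriesSr IH addnS seriesSr addrAC.
have [|k /andP[kT Tk]] := @euler_index R (fun k => a (m + k)%N) T _ (ltW T0).
  have /cvgryPgt/(_ (T + series a m)) [q _ qP] := aoo.
  exists q; rewrite E ltrBrDr; apply: qP => /=; exact: leq_addl.
by exists k.+1 => //; rewrite (ltW Tk) seriesSr lerD.
Qed.

Section block_recursion.
Context {R : realType} {d : nat} {S : pseudoMetricType R}.
Variables (h : 'rV[R]_d -> S -> 'rV[R]_d) (L b : R).
Hypothesis L0 : 0 < L.
Hypothesis hL : forall x1 x2 s, enorm (h x1 s - h x2 s) <= L * enorm (x1 - x2).
Hypothesis b0 : 0 <= b.
Hypothesis hb : forall y, enorm (h 0 y) <= b.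

(** Strong induction: while the bound holds no noise is switched off, so [x / r - V] follows the
    rescaled scheme; Gronwall and [|V| <= 1] then give the bound at the next index. *)
Lemma block_recursion (x M V : nat -> 'rV[R]_d) (s : nat -> S) (a : nat -> R)
    (r T : R) (N : nat) (C := euler_bound L b T + 1) :
  1 <= r -> enorm (x 0%N) <= r -> (forall k, 0 <= a k) -> series a N <= T ->
  (forall k, x k.+1 = x k + a k *: (h (x k) (s k) + M k)) -> V 0%N = 0 ->
  (forall k, (k < N)%N ->
     V k.+1 = V k + (if enorm (x k) <= C * r then a k / r else 0) *: M k) ->
  (forall k, (k <= N)%N -> enorm (V k) <= 1) ->
  (forall k, (k <= N)%N -> enorm (x k) <= C * r) /\
  (forall k, (k < N)%N -> r^-1 *: x k.+1 - V k.+1 =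
     r^-1 *: x k - V k + a k *: hc h r (r^-1 *: x k - V k + V k) (s k)).
Proof.
move=> r1 x0 a0 aT xS V0 VS V1; have r0 : 0 < r by exact: lt_le_trans r1.
have rN0 : r != 0 by rewrite gt_eqF.
have step k : (k < N)%N -> enorm (x k) <= C * r -> r^-1 *: x k.+1 - V k.+1 =
     r^-1 *: x k - V k + a k *: hc h r (r^-1 *: x k - V k + V k) (s k).
  move=> kN xk; rewrite VS// xk xS.
  have -> : hc h r (r^-1 *: x k - V k + V k) (s k) = r^-1 *: h (x k) (s k).
    by rewrite subrK /hc scalerA mulfV// scale1r.
  rewrite !scalerDr !scalerA [r^-1 * a k]mulrC opprD addrACA; congr (_ + _).
  by rewrite addrK.
suff xC k : (k <= N)%N -> enorm (x k) <= C * r.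
  by split=> // k kN; apply: step => //; apply: xC; exact: ltnW.
have : (k <= k)%N by [].
move: {2}k => n; elim: n k => [|n IH] k.
  rewrite leqn0 => /eqP -> _; rewrite (le_trans x0)// ler_peMl ?(ltW r0)//.
  by rewrite lerDr euler_bound_ge0.
move=> kn kN.
have vk : enorm (r^-1 *: x k - V k) <= euler_bound L b (series a k).
  apply: (@euler_growth _ _ _ h L b L0 hL b0 hb r k a
    (fun k => r^-1 *: x k - V k) V s) => //.
  - by move=> i ik; apply: V1; rewrite (leq_trans (ltnW ik)).
  - by rewrite V0 subr0 enormZ gtr0_norm ?invr_gt0// ler_pdivrMl// mulr1.
  - move=> i ik; have iN := leq_trans ik kN; apply: step => //.
    by apply: IH; [rewrite -ltnS (leq_trans ik)|exact: ltnW].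
have ak : series a k <= T.
  apply: le_trans aT; rewrite -subr_ge0 sub_series_geq// sumr_ge0//.
have u : enorm (r^-1 *: x k) <= C.
  have := enorm_leD (r^-1 *: x k) (V k); rewrite addrC => /le_trans; apply.
  by rewrite lerD ?V1// (le_trans vk)// euler_bound_le.
move: u; rewrite enormZ gtr0_norm ?invr_gt0// ler_pdivrMl// mulrC//.
Qed.

End block_recursion.

(** * The noise over one block *)

Section block_noise.
Context {R : realType} {d : nat} {S : pseudoMetricType R}.
Context {dO : measure_display} {Omega : measurableType dO}.
Variables (P : probability Omega R) (F : nat -> set (set Omega)).
Variables (y : nat -> Omega -> S) (x M : nat -> Omega -> 'rV[R]_d).
Variables (h : 'rV[R]_d -> S -> 'rV[R]_d) (a : nat -> R) (K : R).
Hypothesis hF : filtration F.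
Hypothesis ym : forall n, G_meas (F n) (y n).
Hypothesis x0m : G_meas (F 0%N) (x 0%N).
Hypothesis xS : forall n w, x n.+1 w = x n w + a n *: (h (x n w) (y n w) + M n.+1 w).
Hypothesis hcont : continuous (fun p : 'rV[R]_d * S => h p.1 p.2).
Hypothesis K0 : 0 < K.
Hypothesis Mm : forall n, G_meas (F n.+1) (M n.+1).
Hypothesis M2 : forall n, P.-integrable setT (fun w => (enorm (M n.+1 w) ^+ 2)%:E).
Hypothesis M0 : forall n (j : 'I_d),
  cexp_version P (F n) (fun w => M n.+1 w 0 j) (fun _ => 0).
Hypothesis MK : forall n, exists Z, cexp_version P (F n) (fun w => enorm (M n.+1 w) ^+ 2) Z /\
  {ae P, forall w, Z w <= K * (1 + enorm (x n w) ^+ 2)}.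
Hypothesis a_gt0 : forall n, 0 < a n.
Hypothesis a_le1 : forall n, a n <= 1.

Let sF i : @sigma_algebra Omega setT (F i). Proof. by have [] := hF i. Qed.
Let Fm i : F i `<=` measurable. Proof. by have [] := hF i. Qed.

Lemma iterate_meas n : G_meas (F n) (x n).
Proof.
elim: n => [//|n IH].
have -> : x n.+1 = fun w => x n w + (a n *: h (x n w) (y n w) + a n *: M n.+1 w).
  by apply/funext => w; rewrite xS scalerDr.
have nn1 := leqnSn n.
have hm : G_meas (F n.+1) (fun w => a n *: h (x n w) (y n w)).
  apply: (@G_meas_comp _ _ _ _ _ (fun v : 'rV[R]_d => a n *: v)).
    exact: scaler_continuous.
  apply: (G_meas_filtration_le hF nn1).
  by have := G_meas_pair (sF n) hcont IH (@ym n).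
have am : G_meas (F n.+1) (fun w => a n *: M n.+1 w).
  apply: (@G_meas_comp _ _ _ _ _ (fun v : 'rV[R]_d => a n *: v)) (@Mm n).
  exact: scaler_continuous.
have hMm := G_meas_pair (sF n.+1) (@add_continuous_pair R d) hm am.
by have := G_meas_pair (sF n.+1) (@add_continuous_pair R d)
  (G_meas_filtration_le hF nn1 IH) hMm.
Qed.

Variables (m : nat) (C : R).
Hypothesis C0 : 0 <= C.

Definition block_scale w := Num.max 1 (enorm (x m w)).

(** The test looks only at [x (m + i)], so the factor is known before [M (m + i).+1] is revealed. *)
Definition block_factor i w :=
  if enorm (x (m + i)%N w) <= C * block_scale w then a (m + i)%N / block_scale w else 0.

Lemma block_scale_ge1 w : 1 <= block_scale w.
Proof. by rewrite le_max lexx. Qed.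

Lemma scale_continuous : continuous (fun v : 'rV[R]_d => Num.max 1 (enorm v)).
Proof.
move=> v; have FF : Filter (nbhs v) := nbhs_filter v.
apply: (@continuous_max _ _ (fun=> 1) (@enorm R d)); first exact: cvg_cst.
exact: enorm_continuous.
Qed.

Lemma block_factor_meas i : G_meas (F (m + i)%N) (block_factor i).
Proof.
have xm := G_meas_filtration_le hF (leq_addr i m) (@iterate_meas m).
apply: G_meas_if; [exact: sF| | |exact: G_meas_cst].
- rewrite (_ : [set w | _] = ~` [set w | C * block_scale w < enorm (x (m + i)%N w)]).
    apply: sub_sigma_setC => //.
    have cf : continuous (fun p : 'rV[R]_d * 'rV[R]_d =>
        enorm p.2 - C * Num.max 1 (enorm p.1)).
      move=> p; apply: cvgB.
        apply: (@cvg_comp _ _ _ snd (@enorm R d) _ (nbhs p.2)); first exact: cvg_snd.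
        exact: enorm_continuous.
      apply: cvgM; first exact: cvg_cst.
      apply: (@cvg_comp _ _ _ fst (fun v => Num.max 1 (enorm v)) _ (nbhs p.1)).
        exact: cvg_fst.
      exact: scale_continuous.
    have := G_meas_pair (sF (m + i)%N) cf xm (@iterate_meas (m + i)%N).
    move=> /(_ _ (@open_gt _ 0)).
    by congr (F _ _); rewrite predeqE => w /=; rewrite subr_gt0.
  by rewrite predeqE => w /=; rewrite leNgt; split => /negP.
- have cf : continuous (fun v : 'rV[R]_d => a (m + i)%N / Num.max 1 (enorm v)).
    move=> v; have FF : Filter (nbhs v) := nbhs_filter v.
    apply: (@cvgM _ _ (nbhs v) FF (fun=> a (m + i)%N)
      (fun v => (Num.max 1 (enorm v))^-1)); first exact: cvg_cst.
    apply: (@cvgV _ _ (nbhs v) FF); last exact: scale_continuous.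
    by rewrite gt_eqF// lt_max ltr01.
  exact: (G_meas_comp cf xm).
Qed.

Lemma block_factor_le1 i w : `|block_factor i w| <= 1.
Proof.
have s1 := block_scale_ge1 w; have s0 : 0 < block_scale w by exact: lt_le_trans s1.
rewrite /block_factor; case: ifP => _; last by rewrite normr0.
rewrite ger0_norm ?divr_ge0 ?(ltW s0) ?(ltW (a_gt0 _))//.
by rewrite ler_pdivrMr// mul1r (le_trans (a_le1 _)).
Qed.

(** The squared factor is bounded and known at time [m + i], so [Z] may replace the squared noise;
    where it is nonzero, [1 + |x|^2] is at most [(1 + C^2)] times the squared scale. *)
Lemma block_factor_second_moment i :
  \int[P]_w (block_factor i w ^+ 2 * enorm (M (m + i).+1 w) ^+ 2) <=
  K * (1 + C ^+ 2) * a (m + i)%N ^+ 2.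
Proof.
have [Z [[Zm iZ ZE] ZK]] := MK (m + i)%N.
have iM := @M2 (m + i)%N.
pose X w := enorm (M (m + i).+1 w) ^+ 2 - Z w.
have iX : P.-integrable setT (EFin \o X) by exact: (integrableB measurableT iM iZ).
have X0 B : F (m + i)%N B -> \int[P]_(w in B) X w = 0.
  move=> FB; have mB := Fm FB.
  rewrite RintegralB//; [|exact: integrableS iM|exact: integrableS iZ].
  by rewrite /Rintegral ZE// subrr.
have Ym : G_meas (F (m + i)%N) (fun w => block_factor i w ^+ 2).
  apply: (@G_meas_comp _ _ _ _ _ (fun t : R => t ^+ 2) _ _ (@block_factor_meas i)).
  exact: exprn_continuous.
have Yb w : `|block_factor i w ^+ 2| <= 1 by rewrite normrX exprn_ile1// block_factor_le1.
have mY := G_meas_measurable (@Fm _) Ym.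
have c0 := Rintegral_mul_centered (sF _) (@Fm _) iX X0 Ym Yb.
have iYM := integrable_bounded_mul mY Yb iM; have iYZ := integrable_bounded_mul mY Yb iZ.
have -> : \int[P]_w (block_factor i w ^+ 2 * enorm (M (m + i).+1 w) ^+ 2) =
    \int[P]_w (block_factor i w ^+ 2 * Z w).
  apply/eqP; rewrite -subr_eq0 -RintegralB// -[X in _ == X]c0; apply/eqP.
  by apply: eq_Rintegral => w _; rewrite /X mulrBr.
apply: ae_le_Rintegral_cst => //; apply: filterS ZK => w Zw.
rewrite /block_factor; case: ifPn => [xC|_]; last first.
  by rewrite expr0n mul0r mulr_ge0 ?sqr_ge0// mulr_ge0 ?(ltW K0)// addr_ge0// sqr_ge0.
have s1 := block_scale_ge1 w; set s := block_scale w in s1 xC *.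
have s0 : 0 < s by exact: lt_le_trans s1.
rewrite expr_div_n mulrAC ler_pdivrMr ?exprn_gt0//.
have -> : K * (1 + C ^+ 2) * a (m + i)%N ^+ 2 * s ^+ 2 =
    a (m + i)%N ^+ 2 * (K * ((1 + C ^+ 2) * s ^+ 2)) by ring.
rewrite ler_wpM2l ?sqr_ge0// (le_trans Zw)// ler_pM2l// mulrDl mul1r lerD//.
  by rewrite exprn_ege1.
by rewrite -exprMn ler_pXn2r// ?nnegrE ?enorm_ge0// mulr_ge0 ?(ltW s0).
Qed.

Definition block_noise r := frozen_sum (fun i => M (m + i).+1) block_factor r.

Lemma shifted_filtration : filtration (fun i => F (m + i)%N).
Proof. by move=> i; rewrite addnS; exact: hF. Qed.

Lemma cexp0_Rintegral n j B : F n B -> \int[P]_(w in B) M n.+1 w 0 j = 0.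
Proof.
move=> FB; have [_ _ /(_ B FB)] := M0 n j; rewrite /Rintegral => <-.
by rewrite integral0_eq.
Qed.

Lemma block_noise_measurable r n : measurable [set w | r <= enorm (block_noise r n w)].
Proof.
apply: (@frozen_sum_tail_measurable _ _ _ _ _ (fun i => M (m + i).+1) block_factor
  r shifted_filtration) => i.
  by rewrite addnS; exact: Mm.
exact: block_factor_meas.
Qed.

Lemma block_noise_tail r n : 0 < r ->
  (P [set w | (r <= enorm (block_noise r n w))%R] <=
   ((\sum_(i < n) K * (1 + C ^+ 2) * a (m + i)%N ^+ 2) / r ^+ 2)%:E)%E.
Proof.
move=> r0; apply: (@frozen_sum_tail _ _ _ _ P _ (fun i => M (m + i).+1) block_factor r
  shifted_filtration _ _ _ _ _ (fun i => K * (1 + C ^+ 2) * a (m + i)%N ^+ 2)) => // i.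
- by rewrite addnS; exact: Mm.
- exact: M2.
- by move=> j B FB; exact: cexp0_Rintegral.
- exact: block_factor_meas.
- exact: block_factor_le1.
- exact: block_factor_second_moment.
Qed.

End block_noise.

(** * Borel-Cantelli over the blocks and the pathwise bound *)

Theorem theorem1 (R : realType) (d : nat) (S : pseudoMetricType R)
  (dO : measure_display) (Omega : measurableType dO) (P : probability Omega R)
  (F : nat -> set (set Omega)) (y : nat -> Omega -> S)
  (x M : nat -> Omega -> 'rV[R]_d) (h : 'rV[R]_d -> S -> 'rV[R]_d)
  (a : nat -> R) (L K : R) :
  (* S compact metric space *)
  compact [set: S] -> hausdorff_space S ->
  (* filtration, adaptedness, x_0 F_0-measurable *)
  filtration F -> (forall n, G_meas (F n) (y n)) -> G_meas (F 0%N) (x 0%N) ->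
  (* the recursion *)
  (forall n w, x n.+1 w = x n w + a n *: (h (x n w) (y n w) + M n.+1 w)) ->
  (* (A1) *)
  continuous (fun p : 'rV[R]_d * S => h p.1 p.2) -> 0 < L ->
  (forall x1 x2 s, enorm (h x1 s - h x2 s) <= L * enorm (x1 - x2)) ->
  (* (A2) *)
  0 < K ->
  (forall n, G_meas (F n.+1) (M n.+1)) ->
  (forall n, P.-integrable setT (fun w => (enorm (M n.+1 w) ^+ 2)%:E)) ->
  (forall n (j : 'I_d), cexp_version P (F n) (fun w => M n.+1 w 0 j) (fun _ => 0)) ->
  (forall n, exists Z, cexp_version P (F n) (fun w => enorm (M n.+1 w) ^+ 2) Z /\
       {ae P, forall w, Z w <= K * (1 + enorm (x n w) ^+ 2)}) ->
  (* (A3) *)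
  (forall n, 0 < a n) -> series a @ \oo --> +oo ->
  cvgn (series (fun n => a n ^+ 2)) -> (forall n, a n <= 1) ->
  (* (S1), (S2) *)
  S1 h -> S2 h ->
  {ae P, forall w, exists C : R, forall n, enorm (x n w) <= C}.
Proof.
move=> cS _ hF ym x0m xS hcont L0 hL K0 Mm M2 M0 MK a0 aoo a2 a1 hS1 hS2.
have [b b0 hb] := h0_bounded cS hcont.
have [T [e [c0 [T0 e0 c1 stab]]]] := euler_block_stable cS hcont L0 hL hS1 hS2.
(* No block lasts longer than [T + 1]; the last [+ 1] makes room for the noise. *)
pose C := euler_bound L b (T + 1) + 1.
have C0 : 0 <= C by rewrite addr_ge0// euler_bound_ge0.
(* At most [e] for the block stability, at most 1 for the Gronwall estimate. *)
pose r := Num.min e 1; have r0 : 0 < r by rewrite lt_min e0 ltr01.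
have /choice[len lenP] m : exists N, (0 < N)%N /\
    T <= series (fun k => a (m + k)%N) N <= T + 1.
  by have [N N0 NT] := block_length T0 a0 a1 aoo m; exists N.
pose fix mm n := if n is n'.+1 then (mm n' + len (mm n'))%N else 0%N.
pose V m := block_noise x M a m C r.
pose B n := [set w | r <= enorm (V (mm n) (len (mm n)) w)].
have mB n : measurable (B n).
  exact: (block_noise_measurable hF ym x0m xS hcont Mm).
pose sg := K * (1 + C ^+ 2) / r ^+ 2.
have sg0 : 0 <= sg.
  by rewrite divr_ge0 ?sqr_ge0// mulr_ge0 ?(ltW K0)// addr_ge0// sqr_ge0.
have PB n : (P (B n) <= (sg * \sum_(i < len (mm n)) a (mm n + i)%N ^+ 2)%:E)%E.
  apply: (le_trans (block_noise_tail hF ym x0m xS hcont K0 Mm M2 M0 MK a0 a1 _ C0 _ r0)).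
  by rewrite lee_fin -mulr_sumr mulrAC.
(* The blocks tile the indices, so their sums concatenate to a partial sum of the convergent
   series. *)
have sumB q : \sum_(0 <= n < q) \sum_(i < len (mm n)) a (mm n + i)%N ^+ 2 =
    series (fun k => a k ^+ 2) (mm q).
  elim: q => [|q IH]; first by rewrite big_geq// /series/= big_geq.
  rewrite big_nat_recr//= IH /series/= [RHS](@big_cat_nat _ _ _ (mm q))//=.
    congr (_ + _); move: (len (mm q)) => N; move: (mm q) => m.
    rewrite -{2}[m]add0n big_addn addKn big_mkord.
    by apply: eq_bigr => i _; rewrite addnC.
  exact: leq_addr.
have Bfin : (\sum_(n <oo) P (B n) < +oo)%E.
  pose A2 := limn (series (fun k => a k ^+ 2)).
  apply: (@le_lt_trans _ _ (sg * A2)%:E); last exact: ltry.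
  apply: lime_le; first by apply: is_cvg_nneseries => n _ _; exact: measure_ge0.
  apply: nearW => q; apply: (@le_trans _ _
      (\sum_(0 <= n < q) (sg * \sum_(i < len (mm n)) a (mm n + i)%N ^+ 2)%:E)%E).
    by apply: lee_sum => n _; exact: PB.
  rewrite sumEFin lee_fin -mulr_sumr sumB ler_wpM2l//.
  apply: nondecreasing_cvgn_le => //; apply/nondecreasing_seqP => n.
  by rewrite seriesSr lerDl sqr_ge0.
have lim0 := lim_sup_set_cvg0 mB Bfin.
exists (lim_sup_set B); split => //.
  by apply: bigcap_measurable => // k _; exact: bigcup_measurable.
move=> w nb n _; apply: contrapT => nB; apply: nb.
have {}nB j : (n <= j)%N -> enorm (V (mm j) (len (mm j)) w) < r.
  by move=> nj; rewrite ltNge; apply/negP => rV; apply: nB; exists j.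
have [k0 k0P] : exists k0, forall k, (k0 <= k)%N -> a k <= e.
  have /cvgrPdist_lt/(_ (e ^+ 2)) := cvg_series_cvg_0 a2.
  rewrite exprn_gt0// => /(_ isT)[k0 _ kP]; exists k0 => k kk.
  have := kP k kk; rewrite /= sub0r normrN ger0_norm ?sqr_ge0// => /ltW.
  by rewrite ler_pXn2r// nnegrE ltW.
have mmS j : (mm j < mm j.+1)%N.
  by rewrite /= -{1}[mm j]addn0 ltn_add2l; have [] := lenP (mm j).
(* Block [j] starts no earlier than index [j], so for [k0 <= j] all its steps are at most [e]. *)
have mle j : (j <= mm j)%N by elim: j => // j /leq_ltn_trans; apply.
have block j (m := mm j) (N := len m) (s := block_scale x m w) : (n <= j)%N ->
    (forall k, (k <= N)%N -> enorm (V m k w) < r) /\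
    ((forall k, (k <= N)%N -> enorm (x (m + k)%N w) <= C * s) /\
     (forall k, (k < N)%N -> s^-1 *: x (m + k.+1)%N w - V m k.+1 w =
       s^-1 *: x (m + k)%N w - V m k w + a (m + k)%N *:
       hc h s (s^-1 *: x (m + k)%N w - V m k w + V m k w) (y (m + k)%N w))).
  move=> nj.
  (* A frozen sum stays put once it reaches [r], so an early crossing would persist to the end of
     the block. *)
  have Vr k : (k <= N)%N -> enorm (V m k w) < r.
    move=> kN; rewrite ltNge; apply/negP => rV; have := nB j nj.
    by rewrite /V /block_noise (frozen_sum_stop kN rV) ltNge rV.
  split=> //.
  apply: (@block_recursion _ _ _ h L b L0 hL b0 hb (fun k => x (m + k)%N w)
    (fun k => M (m + k).+1 w) (fun k => V m k w) (fun k => y (m + k)%N w)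
    (fun k => a (m + k)%N) s (T + 1) N).
  - exact: block_scale_ge1.
  - by rewrite addn0 le_max lexx orbT.
  - by move=> k; exact/ltW.
  - by have [_ /andP[]] := lenP m.
  - by move=> k; rewrite addnS xS.
  - by [].
  (* By [Vr] nothing has been frozen, and the coefficient reduces to [block_factor]. *)
  - by move=> k kN; rewrite /V /block_noise /= -/(block_noise _ _ _ _ _ _ _) Vr// ltnW.
  - by move=> k /Vr /ltW /le_trans; apply; rewrite ge_min lexx orbT.
apply: (@blocks_bounded R (fun k => enorm (x k w)) mm C c0 (maxn n k0)) => //.
- by move=> k; exact: enorm_ge0.
- move=> j k; rewrite geq_max => /andP[nj _] /andP[jk kj].
  have [_ [xC _]] := block j nj; rewrite -(subnKC jk); apply: xC.
  by rewrite leq_subLR.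
- move=> j; rewrite geq_max => /andP[nj kj] cx.
  have [Vr [_ vS]] := block j nj; set m := mm j in cx Vr vS *.
  (* A norm above [c0 >= 1] is its own scale: the scheme starts on the unit sphere, and ending in
     the unit ball means that the norm has not grown. *)
  have sE : block_scale x m w = enorm (x m w).
    by rewrite /block_scale max_r// (le_trans c1).
  have s0 : 0 < enorm (x m w) by rewrite (lt_le_trans _ cx)// (lt_le_trans _ c1).
  rewrite sE in vS; have [N0 NT] := lenP m.
  have := stab _ (len m) (fun k => a (m + k)%N)
    (fun k => (enorm (x m w))^-1 *: x (m + k)%N w - V m k w) (fun k => V m k w)
    (fun k => y (m + k)%N w) cx.
  rewrite subrK enormZ gtr0_norm ?invr_gt0// ler_pdivrMl// mulr1; apply => //.
  + move=> k _; rewrite a0 k0P//= (leq_trans kj)// (leq_trans (mle j))//.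
    exact: leq_addr.
  + by move=> k /Vr /ltW /le_trans; apply; rewrite ge_min lexx.
  + by rewrite addn0 subr0 enormZ gtr0_norm ?invr_gt0// mulVf ?gt_eqF.
Qed.
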